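(* Assume that $\mathfrak{f}=\mathfrak{h}\oplus\mathfrak{z}$ is a reductive Lie algebra of dimension $d_1$ (with underlying space $\mathbb{C}^{d_1}$, $\mathfrak{h}$ the semisimple ideal and $\mathfrak{z}$ the center), and $[\lambda]$ is a critical point of $F_m:S_m\to\mathbb{R}$ of type $(k_2<\cdots<k_r;d_2,\dots,d_r)$ where $k_2>0$, with $\mathrm{M}_\lambda=c_\lambda I+D_\lambda$, $c_\lambda\in\mathbb{R}$, $D_\lambda\in\mathrm{Der}(\lambda)$. Consider the direct sum $\mu=\mathfrak{f}\ltimes_\rho\lambda$, where $\rho=(L^\rho,R^\rho)$, and $L^\rho:\mathbb{C}^{d_1}\times\mathbb{C}^m\to\mathbb{C}^m$, $R^\rho:\mathbb{C}^m\times\mathbb{C}^{d_1}\to\mathbb{C}^m$ are bilinear mappings such that $\mu$ is a symmetric Leibniz algebra on $\mathbb{C}^{d_1}\oplus\mathbb{C}^m$ with bracket relations given by $$\mu(A+X,B+Y):=\operatorname{ad}_{\mathfrak{f}}A(B)+L^\rho_A(Y)+R^\rho_B(X)+\lambda(X,Y)$$ for all $A,B\in\mathbb{C}^{d_1}$, $X,Y\in\mathbb{C}^m$. Assume that the following conditions are satisfied: (i) $[D_\lambda,L^\rho_A]=0$ and $[D_\lambda,R^\rho_A]=0$ for all $A\in\mathbb{C}^{d_1}$. (ii) $[L^\rho_Z,(L^\rho_Z)^*]=0$ and $[R^\rho_Z,(R^\rho_Z)^*]=0$ for all $Z\in\mathfrak{z}$; and for each $0\neq Z\in\mathfrak{z}$,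 $L^\rho_Z$ or $R^\rho_Z$ is not zero. Let $\langle\cdot,\cdot\rangle_1$ be a Hermitian inner product on $\mathfrak{f}$ and $\{H_i\mid H_i\in\mathfrak{h}\}\cup\{Z_i\mid Z_i\in\mathfrak{z}\}$ be an orthonormal basis of $(\mathfrak{f},\langle\cdot,\cdot\rangle_1)$ such that $(\operatorname{ad}_{\mathfrak{f}}H_i)^{*1}=-\operatorname{ad}_{\mathfrak{f}}H_i$, $(L^\rho_{H_i})^*=-L^\rho_{H_i}$, $(R^\rho_{H_i})^*=-R^\rho_{H_i}$ for all $i$. If we extend the Hermitian inner product on $\mathbb{C}^m$ to $\mathbb{C}^{d_1}\oplus\mathbb{C}^m$ (with the two summands orthogonal) by setting $$\langle A,B\rangle=-\frac{2}{c_\lambda}\left(\operatorname{tr}\operatorname{ad}_{\mathfrak{f}}A(\operatorname{ad}_{\mathfrak{f}}B)^{*1}+\operatorname{tr}L^\rho_A(L^\rho_B)^*+\operatorname{tr}R^\rho_A(R^\rho_B)^*\right),\qquad A,B\in\mathbb{C}^{d_1},$$ then $[\mu]$ is a critical point of type $(0<k_2<\cdots<k_r;d_1,d_2,\dots,d_r)$ for $F_n:S_n\to\mathbb{R}$, $n=d_1+m$.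
   Context: Let $V_n=\otimes^2(\mathbb{C}^n)^*\otimes\mathbb{C}^n$ be the space of all bilinear maps $\mu:\mathbb{C}^n\times\mathbb{C}^n\to\mathbb{C}^n$. $\mathrm{GL}(n)$ acts on $V_n$ by $g.\mu(X,Y)=g\mu(g^{-1}X,g^{-1}Y)$, and $\mathrm{Der}(\mu)$ is the derivation algebra of $\mu$. Fix a Hermitian inner product on $\mathbb{C}^n$; it induces the Hermitian inner product $\langle\mu,\lambda\rangle=\sum_{i,j,k}\langle\mu(X_i,X_j),X_k\rangle\overline{\langle\lambda(X_i,X_j),X_k\rangle}$ on $V_n$, where $\{X_i\}$ is any orthonormal basis of $\mathbb{C}^n$. On $\mathfrak{gl}(n)$ put $(A,B)=\operatorname{tr}AB^*$, where $^*$ is the conjugate transpose with respect to the fixed inner product; $\mathrm{i}\mathfrak{u}(n)$ is the space of Hermitian operators. The moment map $m:\mathbb{P}V_n\to\mathrm{i}\mathfrak{u}(n)$ is defined by $(m([\mu]),A)=(\mathrm{d}\rho_\mu)_eA/\|\mu\|^2$ for $A\in\mathrm{i}\mathfrak{u}(n)$, where $\rho_\mu(g)=\langle g.\mu,g.\mu\rangle$, and $F_n([\mu])=\|m([\mu])\|^2$. With $L^\mu_X(Y)=\mu(X,Y)$, $R^\mu_X(Y)=\mu(Y,X)$, set $\mathrm{M}_\mu=2\sum_iL^\mu_{X_i}(L^\mu_{X_i})^*-2\sum_i(L^\mu_{X_i})^*L^\mu_{X_i}-2\sum_i(R^\mu_{X_i})^*R^\mu_{X_i}$; one has $m([\mu])=\mathrm{M}_\mu/\|\mu\|^2$.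 It is known that $[\mu]$ is a critical point of $F_n:\mathbb{P}V_n\to\mathbb{R}$ iff $\mathrm{M}_\mu=c_\mu I+D_\mu$ with $c_\mu\in\mathbb{R}$, $D_\mu\in\mathrm{Der}(\mu)$, and that then $c_\mu=\operatorname{tr}\mathrm{M}_\mu^2/\operatorname{tr}\mathrm{M}_\mu<0$. Type: for a critical point $[\mu]$ with $\mathrm{M}_\mu=c_\mu I+D_\mu$ there is a constant $c>0$ such that the eigenvalues of $cD_\mu$ are integers $k_1<\cdots<k_r$ prime to each other, with multiplicities $d_1,\dots,d_r$; the data $(k_1<\cdots<k_r;d_1,\dots,d_r)$ is the type of $[\mu]$. A symmetric Leibniz algebra is an algebra satisfying $x(yz)=(xy)z+y(xz)$ and $(xy)z=(xz)y+x(yz)$ for all $x,y,z$. $S_n\subset\mathbb{P}V_n$ is the projectivization of the algebraic variety of all symmetric Leibniz algebra structures on $\mathbb{C}^n$. The critical points of $F_n:S_n\to\mathbb{R}$ are precisely the critical points of $F_n:\mathbb{P}V_n\to\mathbb{R}$ that lie in $S_n$. Notation: $L^\rho_A(Y)=L^\rho(A,Y)$ and $R^\rho_A(X)=R^\rho(X,A)$ are operators on $\mathbb{C}^m$; their adjoints $^*$ are taken with respect to the fixed Hermitian inner product on $\mathbb{C}^m$. $\operatorname{ad}_{\mathfrak{f}}A(B)=[A,B]$ is the Lie bracket in $\mathfrak{f}$, and $^{*1}$ denotes the adjoint with respect to $\langle\cdot,\cdot\rangle_1$. A reductive Lie algebra is the direct sum of its center and a semisimple ideal. The space $\mathbb{C}^{d_1}\oplus\mathbb{C}^m$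 with the extended inner product plays the role of $\mathbb{C}^n$ with its fixed Hermitian inner product. *)

(* Defs.v *)
From HB Require Import structures.
From mathcomp Require Import all_boot all_order all_algebra sesquilinear.
From mathcomp Require Import complex.
From mathcomp Require Import boolp classical_sets reals topology normedtype derive.

Set Implicit Arguments.
Unset Strict Implicit.
Unset Printing Implicit Defensive.
Import Order.TTheory GRing.Theory Num.Theory Num.Def.
Import numFieldNormedType.Exports passmx.
Local Open Scope classical_set_scope.
Local Open Scope complex_scope.
Local Open Scope ring_scope.

(* A product on V, i.e. a bilinear map V x V -> V, is encoded in curried form:
   mu x y is the product of x and y, and mu x : 'End(V) is the left
   multiplication L_x. *)
Notation product_on V := ('Hom(V, 'End(V))).

Section Algebras.
Variables (K : fieldType) (V : vectType K).
Implicit Types (mu : product_on V) (U W : {vspace V}).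

Definition rmult mu (x : V) : 'End(V) := linfun (fun y => mu y x).

Lemma rmultE mu x y : rmult mu x y = mu y x.
Proof.
have lin : linear (fun y => mu y x).
  by move=> a u v; rewrite linearP add_lfunE scale_lfunE.
pose f := GRing.isLinear.Build K V V *:%R _ lin.
pose g : {linear V -> V} := HB.pack (fun y => mu y x) f.
by rewrite /rmult (lfunE g).
Qed.

Definition derivation mu (D : 'End(V)) : Prop :=
  forall x y, D (mu x y) = mu (D x) y + mu x (D y).

Definition symmetric_leibniz mu : Prop := forall x y z,
  mu x (mu y z) = mu (mu x y) z + mu y (mu x z) /\
  mu (mu x y) z = mu (mu x z) y + mu x (mu y z).

Definition lie_algebra mu : Prop :=
  (forall x, mu x x = 0) /\
  (forall x y z, mu x (mu y z) + mu y (mu z x) + mu z (mu x y) = 0).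

(* The span of all the brackets [u, w] with u in U and w in W. *)
Definition bracket_space mu U W : {vspace V} :=
  (\sum_(u <- vbasis U) (mu u @: W))%VS.

Definition derived_series mu U (k : nat) : {vspace V} :=
  iter k (fun W => bracket_space mu W W) U.

Definition solvable_space mu U : Prop :=
  exists k, derived_series mu U k = 0%VS.

Definition ideal_of mu (h U : {vspace V}) : Prop :=
  (U <= h)%VS /\ (forall x y, x \in h -> y \in U -> mu x y \in U).

Definition semisimple mu (h : {vspace V}) : Prop :=
  forall U, ideal_of mu h U -> solvable_space mu U -> U = 0%VS.

Definition is_center mu (z : {vspace V}) : Prop :=
  forall x, x \in z <-> forall y, mu x y = 0.

Definition reductive mu (h z : {vspace V}) : Prop :=
  [/\ lie_algebra mu, ideal_of mu fullv h, semisimple mu h, is_center mu z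
    & (h + z)%VS = fullv /\ (h :&: z)%VS = 0%VS].

Definition lftrace (f : 'End(V)) : K :=
  \tr (mxof (vbasis {:V}) (vbasis {:V}) f).

(* (g . mu)(x, y) = g mu(g^-1 x, g^-1 y); meant for invertible g. *)
Definition gl_act (g : 'End(V)) mu : product_on V :=
  linfun (fun x => (g \o mu (g^-1%VF x) \o g^-1)%VF).

Lemma gl_actE g mu x y : gl_act g mu x y = g (mu (g^-1%VF x) (g^-1%VF y)).
Proof.
have lin : linear (fun x => (g \o mu (g^-1%VF x) \o g^-1)%VF).
  move=> a u v; rewrite linearP linearP comp_lfunDr comp_lfunDl.
  by rewrite -comp_lfunZr -comp_lfunZl.
pose f := GRing.isLinear.Build K V 'End(V) *:%R _ lin.
pose h : {linear V -> 'End(V)} :=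
  HB.pack (fun x => (g \o mu (g^-1%VF x) \o g^-1)%VF) f.
by rewrite /gl_act (lfunE h) /= !comp_lfunE.
Qed.

End Algebras.

Section MomentMap.
Variables (R : realType) (V : vectType R[i]) (ip : {dot V for conjC}).
Implicit Types (mu nu : product_on V) (A B D : 'End(V)).

Definition orthonormal_basis (X : seq V) : Prop :=
  basis_of {:V} X /\ orthonormal ip X.

(* An arbitrary orthonormal basis; nothing below depends on the choice. *)
Definition onb : (\dim {:V}).-tuple V :=
  xget (vbasis {:V}) [set X | orthonormal_basis X].

Definition adj A : 'End(V) :=
  xget (0 : 'End(V)) [set B : 'End(V) | forall x y, ip (A x) y = ip x (B y)].

Definition selfadjoint A : Prop := adj A = A.

Definition normal_op A : Prop := (A \o adj A = adj A \o A)%VF.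

Definition op_ip A B : R[i] := lftrace (A \o adj B)%VF.

Definition prod_ip mu nu : R[i] :=
  \sum_(x <- onb) \sum_(y <- onb) \sum_(z <- onb)
    ip (mu x y) z * conjC (ip (nu x y) z).

Definition prod_sqnorm mu : R := complex.Re (prod_ip mu mu).

Definition rho mu (g : 'End(V)) : R := prod_sqnorm (gl_act g mu).

(* GL(V) is open in 'End(V), so the differential of rho mu at the identity in
   the direction A may be computed along the line 1 + t A. *)
Definition is_moment mu (m : 'End(V)) : Prop :=
  selfadjoint m /\
  forall A, selfadjoint A ->
    is_derive (0 : R) (1 : R)
      (fun t : R => rho mu (\1%VF + t%:C *: A))
      (complex.Re (op_ip m A) * prod_sqnorm mu).

Definition moment_map mu : 'End(V) := xget (0 : 'End(V)) [set m : 'End(V) | is_moment mu m].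

Definition Fsq mu : R := complex.Re (op_ip (moment_map mu) (moment_map mu)).

(* [mu] is a critical point of F on the projective space of products.  As
   mu |-> [mu] is a submersion away from 0, this says that the differential at
   mu of the function induced by F on nonzero products vanishes. *)
Definition critical mu : Prop :=
  mu != 0 /\
  forall nu, is_derive (0 : R) (1 : R) (fun t : R => Fsq (mu + t%:C *: nu)) 0.

(* The set of symmetric Leibniz structures may be singular: its critical points
   are those of F on the whole projective space that lie on it. *)
Definition leibniz_critical mu : Prop := symmetric_leibniz mu /\ critical mu.

Definition Mop mu : 'End(V) :=
    2 *: (\sum_(x <- onb) (mu x \o adj (mu x))%VF)
  - 2 *: (\sum_(x <- onb) (adj (mu x) \o mu x)%VF)
  - 2 *: (\sum_(x <- onb) (adj (rmult mu x) \o rmult mu x)%VF).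

Definition Mop_decomposition mu (c : R) D : Prop :=
  Mop mu = c%:C *: \1%VF + D /\ derivation mu D.

(* The spectrum of D is ks with multiplicities ds.  Multiplicities are
   geometric: this is only used for multiples of D = Mop mu - c, which is
   self-adjoint. *)
Definition has_spectrum D (ks : seq int) (ds : seq nat) : Prop :=
  [/\ size ks = size ds,
      forall a : R[i],
        leigenvalue D a <-> exists2 k, k \in ks & a = k%:~R
    & forall j, (j < size ks)%N ->
        \dim (leigenspace D (nth 0 ks j)%:~R) = nth 0%N ds j].

(* "Prime to each other" means that the gcd of all the ks is 1; the degenerate
   case D = 0 has type (0; n). *)
Definition has_type mu (ks : seq int) (ds : seq nat) : Prop :=
  [/\ sorted <%R ks,
      ks = [:: 0] \/ \big[gcdn/0%N]_(k <- ks) `|k|%N = 1%N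
    & exists c D (a : R),
        [/\ Mop_decomposition mu c D, 0 < a & has_spectrum (a%:C *: D) ks ds]].

Definition leibniz_critical_of_type mu (ks : seq int) (ds : seq nat) : Prop :=
  leibniz_critical mu /\ has_type mu ks ds.

End MomentMap.

(* Main.v *)
(* The moment map is M_mu / |mu|^2, which is seen by evaluating the derivative of
   rho_mu in an orthonormal eigenbasis of the direction.  If M_mu = c + D with D a
   derivation, then tr (M_(mu,nu) M_mu) = - 2c <mu, nu>, M_(mu,nu) being the
   polarisation of M_mu, so F = tr M^2 / |mu|^4 is stationary at mu, and
   tr M^2 = c tr M = - 2c |mu|^2 forces c < 0.

   For the extension, invariance of the new inner product under ad h yields an
   orthonormal basis of f made of elements which act by skew operators or are
   central, hence all acting by normal operators.  Evaluating M_mu on that basis,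
   normality cancels the contribution of f on C^m, the Casimir-like terms on f add
   up to c times the inner product by its very definition, and the mixed terms
   vanish since D_lambda is invertible and commutes with L and R. *)

Require Import Defs.
From HB Require Import structures.
From mathcomp Require Import all_boot all_order all_algebra sesquilinear.
From mathcomp Require Import complex.
From mathcomp Require Import boolp classical_sets functions reals topology.
From mathcomp Require Import normedtype derive spectral.
From mathcomp Require Import ring.

Set Implicit Arguments.
Unset Strict Implicit.
Unset Printing Implicit Defensive.
Import Order.TTheory GRing.Theory Num.Theory Num.Def.
Import numFieldNormedType.Exports.
Local Open Scope complex_scope.
Local Open Scope ring_scope.

(** Two mismatches of inner products shape the extension step. The form on [f] is built from traces
    of adjoints for [ip1], while M of the extension uses adjoints for the new inner product; both
    adjoints of [ad A] must be shown equal before the definition of the form can be used. And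
    [Hs ++ Zs] is orthonormal for [ip1] only. Orthonormalising it again with complex coefficients
    could destroy skewness, as i times a skew operator is Hermitian; hence a Gram-Schmidt process
    confined to a class of vectors that need not be a complex subspace.

    The factor - 2/c has its origin in the coefficients of M: on [f] there remains - 2 times the
    trace form, which has to be c times the inner product. It is positive because c < 0.

    On the analytic side, rho is studied along 1 + tA and F along mu + t nu. Near t = 0 both are
    sums or quotients of polynomials in t, so all the calculus reduces to the quotient rule at 0. *)

(** * Inner products, Gram-Schmidt and orthonormal bases *)

Section DotForms.
Variables (R : realType) (V : vectType R[i]).
Local Notation C := (R[i]).

(** Hermitian symmetry turns linearity in the first slot into conjugate-linearity in the second. The
    inner products on [f] and on the direct sum are both obtained this way. *)
Lemma dot_of_form (f : V -> V -> C) :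
    (forall w, linear_for *%R (f^~ w)) ->
    (forall u v, f u v = conjC (f v u)) ->
    (forall u, u != 0 -> 0 < f u u) ->
  exists ip : {dot V for conjC}, forall u v, ip u v = f u v.
Proof.
move=> flin fherm fpos.
have frlin u : linear_for (conjC \; *%R) (f u).
  by move=> a v w; rewrite fherm flin rmorphD rmorphM /= -!fherm.
pose b := bilinear_isBilinear.Build C V V C *%R (conjC \; *%R) f (flin, frlin).
have hh u v : f u v = (-1) ^+ false * conjC (f v u) by rewrite mul1r -fherm.
pose hm := isHermitianSesquilinear.Build C V false conjC f hh.
pose dm := isDotProduct.Build C V f fpos.
pose ip : {dot V for conjC} := HB.pack f b hm dm.
by exists ip.
Qed.

Variable ip : {dot V for conjC}.
Implicit Types (u v w x y : V) (E F : seq V).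

Lemma dotC u v : ip u v = conjC (ip v u).
Proof. by rewrite hermC mul1r. Qed.

Lemma orthonormal_dot E :
  orthonormal ip E -> {in E &, forall x y, ip x y = (x == y)%:R}.
Proof. by case/orthonormalP. Qed.

Lemma orthonormal_uniq E : orthonormal ip E -> uniq E.
Proof. by case/orthonormalP. Qed.

Lemma orthonormal_residue E u : orthonormal ip E ->
  {in E, forall e, ip (u - \sum_(f <- E) ip u f *: f) e = 0}.
Proof.
move=> oE e eE; rewrite linearBl linear_sumlz (bigD1_seq e) ?orthonormal_uniq //=.
rewrite linearZl_LR /= (orthonormal_dot oE eE eE) eqxx mulr1 big_seq_cond big1.
  by rewrite addr0 subrr.
move=> f /andP[fE nef].
by rewrite linearZl_LR /= (orthonormal_dot oE fE eE) (negPf nef) mulr0.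
Qed.

(** Only two operations occur, taking a residue and normalising, so any class [P] stable under them
    is preserved. The trivial class gives the extension of orthonormal families; the class of
    elements acting by skew operators is the other use. *)
Lemma gram_schmidt (P : V -> Prop) (E X : seq V) :
    (forall (F : seq V) u, P u -> {in F, forall e, P e} ->
       P (u - \sum_(e <- F) ip u e *: e)) ->
    (forall u, P u -> P ((sqrtC (ip u u))^-1 *: u)) ->
    orthonormal ip E -> {in E, forall e, P e} -> {in X, forall x, P x} ->
  exists F, [/\ orthonormal ip (F ++ E), {in F, forall e, P e}
              & <<F ++ E>>%VS = <<X ++ E>>%VS].
Proof.
move=> PB PZ oE PE; elim: X => [|x X IH] PX; first by exists [::].
have [F [oF PF sF]] := IH (sub_in1 (mem_behead (s := x :: X)) PX).
set G := F ++ E in oF sF.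
have PG : {in G, forall e, P e}.
  by move=> e; rewrite mem_cat => /orP[/PF|/PE].
pose w := x - \sum_(e <- G) ip x e *: e.
have wG : {in G, forall e, ip w e = 0} by exact: orthonormal_residue.
have sumG : \sum_(e <- G) ip x e *: e \in <<G>>%VS.
  by rewrite big_seq rpred_sum // => e eG; rewrite rpredZ // memv_span.
have xE : x = w + \sum_(e <- G) ip x e *: e by rewrite subrK.
have [w0|w0] := eqVneq w 0.
  exists F; split=> //; rewrite -/G sF cat_cons span_cons -sF.
  by apply/esym/addv_idPr; rewrite -memvE xE w0 add0r.
pose e := (sqrtC (ip w w))^-1 *: w.
have sw0 : sqrtC (ip w w) != 0 by rewrite sqrtC_eq0 dnorm_eq0.
exists (e :: F); split.
- rewrite cat_cons -/G -cat1s orthonormal_cat oF /= /orthonormal /=.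
  apply/and3P; split=> //; last first.
    apply/allP => f fG /=.
    by rewrite /e linearZl_LR /= (wG f) // mulr0.
  rewrite /e !andbT dnormZ normfV exprVn ger0_norm ?sqrt_dnorm_ge0 //.
  by rewrite sqrtCK mulVf // dnorm_eq0.
- move=> f; rewrite inE => /predU1P[->|/PF //].
  by apply: PZ; apply: PB => //; apply: PX; rewrite mem_head.
- rewrite !cat_cons !span_cons -sF -/G; apply/eqP; rewrite eqEsubv !subv_add.
  rewrite !addvSr !andbT -!memvE; apply/andP; split.
      apply/memvZ/memvB; first exact: subvP (addvSl _ _) _ (memv_line _).
    exact: subvP (addvSr _ _) _ sumG.
  rewrite {1}xE memv_add // -[w](scalerKV sw0) -/e memvZ ?memv_line //.
Qed.

Lemma orthonormal_extend E :
  orthonormal ip E -> exists F, orthonormal_basis ip (F ++ E).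
Proof.
move=> oE; have T0 (F : seq V) : {in F, forall e, True} by [].
have [//|F [oF _ sF]] :=
  @gram_schmidt (fun=> True) E (vbasis {:V}) (fun _ _ _ _ => I) _ oE (T0 _) (T0 _).
exists F; split=> //; rewrite /basis_of (orthonormal_free oF) andbT.
rewrite sF span_cat eqEsubv subvf /=.
by apply: subv_trans (addvSl _ _); rewrite (span_basis (vbasisP _)).
Qed.

Lemma onbP : orthonormal_basis ip (onb ip).
Proof.
have [F] := @orthonormal_extend [::] isT; rewrite cats0 => Fb.
have sF : size F == \dim {:V} by case: Fb => /andP[/eqP <- /eqP <-].
rewrite /onb; case: xgetP => [x -> //|/(_ (Tuple sF))]; exact.
Qed.

Section Basis.
Variables (E : seq V) (bE : orthonormal_basis ip E).

Lemma onb_eq0 u : {in E, forall e, ip u e = 0} -> u = 0.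
Proof.
move=> uE; apply/eqP; rewrite -(dnorm_eq0 ip); apply/eqP.
apply: (@span_orthogonal _ _ ip [:: u] E); last 2 first.
- by rewrite memv_span ?mem_head.
- by rewrite (span_basis bE.1) memvf.
- by rewrite /orthogonal /= andbT; apply/allP => e /uE /eqP.
Qed.

Lemma onb_sum u : u = \sum_(e <- E) ip u e *: e.
Proof.
by apply/eqP; rewrite -subr_eq0; apply/eqP/onb_eq0/orthonormal_residue/bE.2.
Qed.

Lemma onb_dot u v : ip u v = \sum_(e <- E) ip u e * ip e v.
Proof.
rewrite {1}[u]onb_sum linear_sumlz.
by under eq_bigr do rewrite linearZl_LR.
Qed.

Lemma lftrace_onb (f : 'End(V)) : lftrace f = \sum_(e <- E) ip (f e) e.
Proof.
pose b := vbasis {:V}.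
have tE : lftrace f = \sum_i coord b i (f b`_i).
  by apply: eq_bigr => i _; rewrite !mxE /= passmx.vecof_delta.
(* The coordinate is moved inside [f], so that after exchanging the sums the one over i rebuilds e
   from its coordinates. *)
have fE i : coord b i (f b`_i) = \sum_(e <- E) ip (f (coord b i e *: b`_i)) e.
  rewrite {1}[f _]onb_sum linear_sum; apply: eq_bigr => e _.
  by rewrite linearZ [in RHS]linearZ /= linearZl_LR mulrC.
rewrite tE; under eq_bigr do rewrite fE.
rewrite exchange_big /=; apply: eq_bigr => e _.
by rewrite -linear_sumlz -linear_sum -(coord_basis (vbasisP _) (memvf e)).
Qed.

End Basis.

End DotForms.

(** * Bilinear products and the trace *)

Lemma linfun_linear (K : fieldType) (U W : vectType K) (f : U -> W) :
  linear f -> forall x, linfun f x = f x.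
Proof.
move=> lin x; pose g := GRing.isLinear.Build K U W *:%R _ lin.
pose h : {linear U -> W} := HB.pack f g.
by rewrite (lfunE h).
Qed.

Lemma linear_rmult (K : fieldType) (V : vectType K) (mu : product_on V) y :
  linear (fun x => mu x y).
Proof. by move=> a u v; rewrite linearP add_lfunE scale_lfunE. Qed.

Section ProductScaling.
Variables (K : fieldType) (V : vectType K) (mu : product_on V).

Lemma productZl a x y : mu (a *: x) y = a *: mu x y.
Proof. by rewrite [mu _]linearZ /= scale_lfunE. Qed.

Lemma productZr b x y : mu x (b *: y) = b *: mu x y.
Proof. by rewrite linearZ. Qed.

Lemma productZZ a b x y : mu (a *: x) (b *: y) = (a * b) *: mu x y.
Proof. by rewrite productZl productZr scalerA. Qed.

Lemma productDl x x' y : mu (x + x') y = mu x y + mu x' y.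
Proof. by rewrite [mu _]linearD add_lfunE. Qed.

Lemma productDr x y y' : mu x (y + y') = mu x y + mu x y'.
Proof. by rewrite linearD. Qed.

Lemma productNr x y : mu x (- y) = - mu x y.
Proof. by rewrite linearN. Qed.

End ProductScaling.

Section Trace.
Variables (K : fieldType) (V : vectType K).
Implicit Types A B : 'End(V).

Lemma lftraceP a A B : lftrace (a *: A + B) = a * lftrace A + lftrace B.
Proof. by rewrite /lftrace passmx.mxof_linear mxtraceD mxtraceZ. Qed.

HB.instance Definition _ :=
  GRing.isLinear.Build K 'End(V) K *%R (@lftrace K V) lftraceP.

Lemma lftraceN A : lftrace (- A) = - lftrace A.
Proof. exact: linearN. Qed.

Lemma lftraceB A B : lftrace (A - B) = lftrace A - lftrace B.
Proof. exact: linearB. Qed.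

Lemma lftraceC A B : lftrace (A \o B)%VF = lftrace (B \o A)%VF.
Proof.
by rewrite /lftrace !(passmx.mxof_comp _ _ (vbasisP _)) mxtrace_mulC.
Qed.

End Trace.

(** * Adjoints and the spectral theorem for self-adjoint operators *)

Section Adjoint.
Variables (R : realType) (V : vectType R[i]) (ip : {dot V for conjC}).
Local Notation "A ^a" := (adj ip A) (at level 2, format "A ^a").
Implicit Types (A B : 'End(V)) (E F : seq V).

(** Expanding e along [F] produces coefficients that recombine with g e into g a, by the expansion
    of a along [E]. This frees the sums over [onb] from the chosen basis. *)
Lemma onb_sum_dot (W : vectType R[i]) (ipW : {dot W for conjC}) E F
    (f g : V -> W) :
    orthonormal_basis ip E -> orthonormal_basis ip F -> linear f -> linear g ->
  \sum_(e <- E) ipW (f e) (g e) = \sum_(e <- F) ipW (f e) (g e).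
Proof.
move=> bE bF lf lg.
pose f' := linfun f; pose g' := linfun g.
have f'E x : f x = f' x by rewrite linfun_linear.
have g'E x : g x = g' x by rewrite linfun_linear.
under eq_bigr do rewrite f'E g'E; under [RHS]eq_bigr do rewrite f'E g'E.
transitivity (\sum_(e <- E) \sum_(a <- F) ip e a * ipW (f' a) (g' e)).
  apply: eq_bigr => e _; rewrite {1}(onb_sum bF e) linear_sum linear_sumlz.
  by apply: eq_bigr => a _; rewrite linearZ linearZl_LR.
rewrite exchange_big /=; apply: eq_bigr => a _.
have -> : g' a = \sum_(e <- E) ip a e *: g' e.
  rewrite {1}(onb_sum bE a) linear_sum; apply: eq_bigr => e _.
  by rewrite linearZ.
by rewrite linear_sumr; apply: eq_bigr => e _; rewrite linearZr_LR /= -dotC.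
Qed.

Lemma adjP A x y : ip (A x) y = ip x (A^a y).
Proof.
have bE := onbP ip.
(* [adj] is a choice, so an adjoint has to be exhibited: its coefficient at e is forced to be the
   product of y with A e. *)
pose b y := \sum_(e <- onb ip) ip y (A e) *: e.
have lb : linear b.
  move=> a u v; rewrite scaler_sumr -big_split; apply: eq_bigr => e _ /=.
  by rewrite linearPl /= scalerDl scalerA.
have AB : forall x y, ip (A x) y = ip x (linfun b y).
  move=> {}x {}y; rewrite linfun_linear // linear_sumr.
  rewrite {1}(onb_sum bE x) linear_sum linear_sumlz; apply: eq_bigr => e _.
  by rewrite linearZ linearZl_LR linearZr_LR /= -dotC mulrC.
by rewrite /adj; case: xgetP => [B -> //|/(_ _ AB)].
Qed.

Lemma adjPr A x y : ip x (A y) = ip (A^a x) y.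
Proof. by rewrite dotC adjP -dotC. Qed.

Lemma dot_inj u v : (forall x, ip x u = ip x v) -> u = v.
Proof.
move=> uv; apply/eqP; rewrite -subr_eq0 -(dnorm_eq0 ip).
by rewrite linearBr /= uv subrr.
Qed.

Lemma adj_unique A B : (forall x y, ip (A x) y = ip x (B y)) -> A^a = B.
Proof.
by move=> AB; apply/lfunP => y; apply: dot_inj => x; rewrite -adjP AB.
Qed.

Lemma adjK A : (A^a)^a = A.
Proof. by apply: adj_unique => x y; rewrite -adjPr. Qed.

Lemma adjPlin a A B : (a *: A + B)^a = conjC a *: A^a + B^a.
Proof.
apply: adj_unique => x y; rewrite !add_lfunE !scale_lfunE.
by rewrite linearPl linearPr /= conjCK !adjP.
Qed.

HB.instance Definition _ :=
  GRing.isLinear.Build R[i] 'End(V) 'End(V) (conjC \; *:%R) (adj ip) adjPlin.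

Lemma adjB A B : (A - B)^a = A^a - B^a.
Proof. exact: linearB. Qed.

Lemma adjZ a A : (a *: A)^a = conjC a *: A^a.
Proof. exact: linearZ. Qed.

Lemma adj_comp A B : (A \o B)%VF^a = (B^a \o A^a)%VF.
Proof. by apply: adj_unique => x y; rewrite !comp_lfunE !adjP. Qed.

Lemma adj_id : (\1%VF : 'End(V))^a = \1%VF.
Proof. by apply: adj_unique => x y; rewrite !id_lfunE. Qed.

Section OrthonormalBasis.
Variables (E : seq V) (bE : orthonormal_basis ip E).

Lemma lftrace_adj A B : lftrace (A \o B^a)%VF = \sum_(e <- E) ip (A e) (B e).
Proof.
rewrite lftraceC (lftrace_onb bE); apply: eq_bigr => e _.
by rewrite comp_lfunE -adjPr.
Qed.

End OrthonormalBasis.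

Lemma lftrace_adj_conj A : lftrace A^a = conjC (lftrace A).
Proof.
rewrite !(lftrace_onb (onbP ip)) rmorph_sum; apply: eq_bigr => e _ /=.
by rewrite -adjPr -dotC.
Qed.

Lemma op_ip_ge0 A : 0 <= op_ip ip A A.
Proof.
rewrite /op_ip (lftrace_adj (onbP ip)); apply: sumr_ge0 => e _.
exact: dnorm_ge0.
Qed.

Lemma op_ip_eq0 A : op_ip ip A A = 0 -> A = 0.
Proof.
rewrite /op_ip (lftrace_adj (onbP ip)) => /eqP.
rewrite psumr_eq0 => [/allP A0|e _]; last exact: dnorm_ge0.
apply/lfunP => x; rewrite lfunE (onb_sum (onbP ip) x) linear_sum big_seq.
rewrite big1 // => e /A0 /=; rewrite dnorm_eq0 => /eqP Ae.
by rewrite [A _]linearZ /= Ae scaler0.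
Qed.

(** The spectral theorem is applied to the matrix of [A] in an orthonormal basis. That matrix acts
    on coordinate rows, so the rows of the diagonalising unitary matrix are the coordinates of the
    eigenvectors. *)
Lemma eigen_onb A : A^a = A -> exists (E : seq V) (a : V -> R),
  orthonormal_basis ip E /\ {in E, forall e, A e = (a e)%:C *: e}.
Proof.
move=> sA; set n := \dim {:V}; pose b := onb ip.
have bE : orthonormal_basis ip b := onbP ip.
have ob (i j : 'I_n) : ip b`_i b`_j = (i == j)%:R.
  rewrite (orthonormal_dot bE.2) ?mem_nth ?size_tuple //.
  by rewrite nth_uniq ?size_tuple // (orthonormal_uniq bE.2).
pose M := \matrix_(i < n, j < n) ip (A b`_i) b`_j.
have MA (i : 'I_n) : A b`_i = \sum_j M i j *: b`_j.
  rewrite [LHS](onb_sum bE) (big_nth 0) big_mkord size_tuple.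
  by apply: eq_bigr => j _; rewrite mxE.
have Mn : M \is normalmx.
  apply/hermitian_normalmx/is_hermitianmxP; rewrite expr0 scale1r.
  by apply/matrixP => i j; rewrite !mxE -dotC adjP sA.
have /orthomx_spectralP := Mn.
set P := spectralmx M; set sp := spectral_diag M => ME.
have PU : P \is unitarymx by exact: spectral_unitarymx.
have PM : P *m M = diag_mx sp *m P.
  by rewrite ME !mulmxA mulmxV ?mul1mx // unitarymx_unit.
pose f i := \sum_j P i j *: b`_j.
have fdot i j : ip (f i) (f j) = (i == j)%:R.
  transitivity ((P *m map_mx conjC P^T) i j); last by rewrite (unitarymxP PU) mxE.
  rewrite mxE linear_sumlz; apply: eq_bigr => k _.
  rewrite linearZl_LR linear_sumr (bigD1 k) //= linearZr_LR /= ob eqxx mulr1.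
  rewrite big1 ?addr0 ?mxE // => l nlk.
  by rewrite linearZr_LR /= ob eq_sym (negPf nlk) mulr0.
have Af i : A (f i) = sp 0 i *: f i.
  rewrite linear_sum scaler_sumr.
  transitivity (\sum_j (P *m M) i j *: b`_j).
    under [RHS]eq_bigr do rewrite mxE scaler_suml.
    rewrite exchange_big; apply: eq_bigr => k _ /=.
    rewrite [A _]linearZ /= MA scaler_sumr.
    by apply: eq_bigr => j _; rewrite scalerA.
  by apply: eq_bigr => j _; rewrite PM mul_diag_mx mxE scalerA.
pose E := [seq f i | i <- enum 'I_n].
have oE : orthonormal ip E.
  have fI : injective f.
    move=> i j fij; have := fdot i j; rewrite fij fdot eqxx.
    by case: eqP => // _ /eqP; rewrite oner_eq0.
  apply/orthonormalP; split; first by rewrite map_inj_uniq ?enum_uniq.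
  move=> _ _ /mapP[i _ ->] /mapP[j _ ->]; rewrite fdot.
  by rewrite (inj_eq fI).
exists E, (fun e => complex.Re (ip (A e) e)); split.
  split=> //; rewrite basisEfree (orthonormal_free oE) subvf /=.
  by rewrite size_map size_enum_ord.
move=> _ /mapP[i _ ->]; rewrite Af linearZl_LR /= fdot eqxx mulr1.
congr (_ *: _); have : sp 0 i \is Num.real.
  have -> : sp 0 i = ip (A (f i)) (f i).
    by rewrite Af linearZl_LR /= fdot eqxx mulr1.
  by apply/CrealP; rewrite -dotC adjP sA.
by move=> /complex_realP[r ->].
Qed.


End Adjoint.

(** * The inner product on products, the operator M and its polarisation *)

Section Products.
Variables (R : realType) (V : vectType R[i]) (ip : {dot V for conjC}).
Local Notation "A ^a" := (adj ip A) (at level 2, format "A ^a").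
Implicit Types (A B D : 'End(V)) (mu nu : product_on V) (E F : seq V).

(** Takes plain functions, so that the infinitesimal action of an operator on a product can be
    inserted without being packaged as a product. *)
Definition dot_on E (f g : V -> V -> V) : R[i] :=
  \sum_(x <- E) \sum_(y <- E) ip (f x y) (g x y).

Lemma dot_on_onb E F (f g : V -> V -> V) :
    orthonormal_basis ip E -> orthonormal_basis ip F ->
    (forall x, linear (f x)) -> (forall y, linear (f^~ y)) ->
    (forall x, linear (g x)) -> (forall y, linear (g^~ y)) ->
  dot_on E f g = dot_on F f g.
Proof.
move=> bE bF fr fl gr gl; rewrite /dot_on.
under eq_bigr do rewrite (onb_sum_dot _ bE bF (fr _) (gr _)).
rewrite exchange_big [RHS]exchange_big /=; apply: eq_bigr => y _.
exact: (onb_sum_dot _ bE bF (fl _) (gl _)).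
Qed.

Lemma linear_mul mu x : linear (mu x).
Proof. by move=> a u v; rewrite linearP. Qed.

Lemma dot_on_mul E F mu nu :
    orthonormal_basis ip E -> orthonormal_basis ip F ->
  dot_on E (fun x y => mu x y) (fun x y => nu x y) =
  dot_on F (fun x y => mu x y) (fun x y => nu x y).
Proof.
by move=> bE bF; apply: dot_on_onb => // x; [exact: linear_mul|exact: linear_rmult
  |exact: linear_mul|exact: linear_rmult].
Qed.

Lemma prod_ip_onb E mu nu :
    orthonormal_basis ip E ->
  prod_ip ip mu nu = dot_on E (fun x y => mu x y) (fun x y => nu x y).
Proof.
move=> bE; rewrite (dot_on_mul mu nu bE (onbP ip)).
apply: eq_bigr => x _; apply: eq_bigr => y _.
rewrite [RHS](onb_dot (onbP ip)); apply: eq_bigr => z _.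
by rewrite [ip z _]dotC.
Qed.

(** Parseval for adjoints. Read forth and back it changes the basis of a sum; read once it exhibits
    the adjoints that normality can then remove. *)
Lemma onb_adj_dot E A B u v : orthonormal_basis ip E ->
  \sum_(e <- E) ip u (B e) * ip (A e) v = ip (B^a u) (A^a v).
Proof.
move=> bE; rewrite [RHS](onb_dot bE); apply: eq_bigr => e _.
by rewrite adjP adjPr.
Qed.

(* Polarisation of the quadratic map Mop. *)
Definition Mpol mu nu : 'End(V) :=
    2 *: (\sum_(x <- onb ip) (mu x \o (nu x)^a)%VF)
  - 2 *: (\sum_(x <- onb ip) ((nu x)^a \o mu x)%VF)
  - 2 *: (\sum_(x <- onb ip) ((rmult nu x)^a \o rmult mu x)%VF).

Lemma Mpol_dot E mu nu u v : orthonormal_basis ip E ->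
  ip (Mpol mu nu u) v =
    2 * (\sum_(x <- E) \sum_(y <- E) ip u (nu x y) * ip (mu x y) v)
    - 2 * (\sum_(x <- E) ip (mu x u) (nu x v))
    - 2 * (\sum_(x <- E) ip (mu u x) (nu v x)).
Proof.
move=> bE; have bF := onbP ip.
rewrite /Mpol !add_lfunE !opp_lfunE !scale_lfunE !sum_lfunE.
rewrite !linearBl !linearZl_LR !linear_sumlz /=.
congr (_ * _ - _ * _ - _ * _).
(* The basis is changed one variable at a time by Parseval, first in y and then in x, where [rmult]
   makes the second variable the parameter. *)
- under [RHS]eq_bigr do rewrite onb_adj_dot // -(onb_adj_dot _ _ _ _ bF).
  rewrite [RHS]exchange_big /=; under [RHS]eq_bigr => y _.
    under eq_bigr do rewrite -!rmultE.
    rewrite (onb_adj_dot _ _ _ _ bE) -(onb_adj_dot _ _ _ _ bF).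
    under eq_bigr do rewrite !rmultE.
    over.
  rewrite [RHS]exchange_big /=; apply: eq_bigr => x _.
  by rewrite (onb_adj_dot _ _ _ _ bF) comp_lfunE; exact: adjP.
- rewrite (onb_sum_dot _ bE bF); first last.
  + exact: linear_rmult.
  + exact: linear_rmult.
  by apply: eq_bigr => x _; rewrite comp_lfunE -adjPr.
- rewrite (onb_sum_dot _ bE bF); first last.
  + exact: linear_mul.
  + exact: linear_mul.
  by apply: eq_bigr => x _; rewrite comp_lfunE -adjPr !rmultE.
Qed.

(* Mpol pairs with A to the infinitesimal action of A on products; taking
   A = D kills it for a derivation, A = 1 gives a multiple of the inner product. *)
Lemma Mpol_trace E mu nu A : orthonormal_basis ip E ->
  lftrace (Mpol mu nu \o A)%VF =
    2 * dot_on E (fun x y => A (mu x y) - mu (A x) y - mu x (A y))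
             (fun x y => nu x y).
Proof.
move=> bE; rewrite (lftrace_onb bE).
under eq_bigr do rewrite comp_lfunE (Mpol_dot _ _ _ _ bE).
rewrite !sumrB -!mulr_sumr -!mulrBr; congr (_ * _).
rewrite /dot_on; under [RHS]eq_bigr => x _.
  under eq_bigr do rewrite !linearBl /=.
  rewrite !sumrB; over.
rewrite !sumrB /= [RHS]addrAC; congr (_ - _ - _).
- rewrite exchange_big /=; apply: eq_bigr => x _.
  rewrite exchange_big /=; apply: eq_bigr => y _.
  rewrite adjP [RHS](onb_dot bE); apply: eq_bigr => e _.
  by rewrite adjP mulrC.
by rewrite exchange_big.
Qed.

Lemma Mpol_adj mu nu : (Mpol mu nu)^a = Mpol nu mu.
Proof.
apply: adj_unique => x y; rewrite [RHS]dotC !(Mpol_dot _ _ _ _ (onbP ip)).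
rewrite !rmorphB !rmorphM /= conjC_nat !rmorph_sum /=.
congr (_ * _ - _ * _ - _ * _).
- apply: eq_bigr => a _; rewrite rmorph_sum; apply: eq_bigr => b _ /=.
  by rewrite rmorphM /= -!dotC mulrC.
- by apply: eq_bigr => a _; rewrite -dotC.
- by apply: eq_bigr => a _; rewrite -dotC.
Qed.

Lemma Mop_adj mu : (Mop ip mu)^a = Mop ip mu.
Proof. exact: Mpol_adj. Qed.

Lemma Mop_trace mu : lftrace (Mop ip mu) = - 2 * prod_ip ip mu mu.
Proof.
have := Mpol_trace mu mu \1 (onbP ip); rewrite comp_lfun1r => ->.
rewrite mulNr -mulrN (prod_ip_onb _ _ (onbP ip)) /dot_on -sumrN; congr (_ * _).
apply: eq_bigr => x _; rewrite -sumrN; apply: eq_bigr => y _.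
by rewrite !id_lfunE subrr add0r linearNl.
Qed.

Lemma Mpol_derivation mu nu D :
  derivation mu D -> lftrace (Mpol mu nu \o D)%VF = 0.
Proof.
move=> dD; rewrite (Mpol_trace _ _ _ (onbP ip)) /dot_on big1 ?mulr0 // => x _.
rewrite big1 // => y _.
by rewrite dD addrAC addrK subrr linear0l.
Qed.

Lemma prod_ip_ge0 mu : 0 <= prod_ip ip mu mu.
Proof.
rewrite (prod_ip_onb _ _ (onbP ip)); apply: sumr_ge0 => x _.
by apply: sumr_ge0 => y _; exact: dnorm_ge0.
Qed.

Lemma prod_ip_eq0 mu : prod_ip ip mu mu = 0 -> mu = 0.
Proof.
have bE := onbP ip; rewrite (prod_ip_onb _ _ bE) => /eqP.
rewrite psumr_eq0 => [/allP mu0|x _]; last first.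
  by apply: sumr_ge0 => y _; exact: dnorm_ge0.
apply/lfunP => x; apply/lfunP => y; rewrite !zero_lfunE.
rewrite (onb_sum bE x) (onb_sum bE y) [mu _]linear_sum sum_lfunE.
rewrite big_seq big1 // => e eE.
rewrite linear_sum big_seq big1 // => f fE.
have /eqP := mu0 e eE; rewrite /= => /eqP.
rewrite psumr_eq0 => [/allP /(_ f fE) /=|a _]; last exact: dnorm_ge0.
rewrite dnorm_eq0 => /eqP ef; rewrite [mu _]linearZ /= scale_lfunE.
by rewrite [mu e (_ *: _)]linearZ /= ef !scaler0.
Qed.

Lemma prod_sqnormE mu : prod_ip ip mu mu = (prod_sqnorm ip mu)%:C.
Proof. by rewrite RRe_real // ger0_real // prod_ip_ge0. Qed.

Lemma prod_sqnorm_gt0 mu : mu != 0 -> 0 < prod_sqnorm ip mu.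
Proof.
move=> mu0; rewrite -ltcR -prod_sqnormE lt_def prod_ip_ge0 andbT.
by apply: contra_neq mu0 => /prod_ip_eq0.
Qed.

Section Decomposition.
Variables (mu : product_on V) (c : R) (D : 'End(V)).
Hypothesis MD : Mop_decomposition ip mu c D.

Lemma Mpol_decomposition nu :
  lftrace (Mpol mu nu \o Mop ip mu)%VF = - (2 * c)%:C * prod_ip ip mu nu.
Proof.
have [ME dD] := MD.
rewrite ME comp_lfunDr linearD /= (Mpol_derivation nu dD) addr0.
rewrite (Mpol_trace _ _ _ (onbP ip)) (prod_ip_onb _ _ (onbP ip)).
rewrite /dot_on !mulr_sumr; apply: eq_bigr => x _.
rewrite !mulr_sumr; apply: eq_bigr => y _.
rewrite !scale_lfunE !id_lfunE !linearZ /= scale_lfunE subrr add0r.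
by rewrite scalerN linearNl linearZl_LR /= rmorphM mulrN mulNr mulrA rmorph_nat.
Qed.

Lemma op_ip_Mop : op_ip ip (Mop ip mu) (Mop ip mu) =
  - (2 * c * prod_sqnorm ip mu)%:C.
Proof.
by rewrite /op_ip Mop_adj Mpol_decomposition prod_sqnormE !rmorphM mulNr.
Qed.

Lemma decomposition_lt0 : mu != 0 -> c < 0.
Proof.
move=> mu0; have n0 := prod_sqnorm_gt0 mu0.
have := op_ip_ge0 ip (Mop ip mu); rewrite op_ip_Mop -rmorphN lecR.
rewrite oppr_ge0 pmulr_lle0 // pmulr_rle0 // le_eqVlt => /orP[/eqP c0|//].
(* The case c = 0 would give |M| = 0, so M = 0, against tr M = - 2|mu|^2. *)
have /op_ip_eq0 M0 : op_ip ip (Mop ip mu) (Mop ip mu) = 0.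
  by rewrite op_ip_Mop c0 mulr0 mul0r oppr0.
have := Mop_trace mu; rewrite M0 linear0 prod_sqnormE => /esym/eqP.
rewrite mulf_eq0 oppr_eq0 pnatr_eq0 /= -(rmorph0 (real_complex R)).
by rewrite (inj_eq (@complexI R)) gt_eqF.
Qed.

End Decomposition.

(** The type of [lambda] carries a decomposition of its own, to be identified with the given one.
    The constant is read off from |M|^2 = - 2c|mu|^2. *)
Lemma decomposition_unique mu c c' D D' : mu != 0 ->
  Mop_decomposition ip mu c D -> Mop_decomposition ip mu c' D' ->
  c = c' /\ D = D'.
Proof.
move=> mu0 MD MD'; have cc' : c = c'.
  have := op_ip_Mop MD'; rewrite (op_ip_Mop MD) => /oppr_inj /complexI.
  move/(mulIf (lt0r_neq0 (prod_sqnorm_gt0 mu0))).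
  by apply: mulfI; rewrite pnatr_eq0.
split=> //; move: MD MD'; rewrite -cc' => [[ME _]] [ME' _].
by apply: (addrI (c%:C *: \1%VF)); rewrite -ME -ME'.
Qed.

End Products.

(** * Derivatives of rational functions at 0 *)

Section Derivatives.
Variable R : realType.

Lemma is_derive_quot (p q : {poly R}) : q.[0] != 0 ->
  is_derive (0 : R) (1 : R) (fun t => p.[t] / q.[t])
    ((p^`().[0] * q.[0] - p.[0] * q^`().[0]) / q.[0] ^+ 2).
Proof.
move=> q0; have dp := is_derive_poly p 0; have dq := is_derive_poly q 0.
have dV : is_derive (0 : R) (1 : R) (fun t => (q.[t])^-1)
    (- q.[0] ^- 2 *: q^`().[0]).
  have [qd qv] := dq; apply: DeriveDef; first exact: derivableV.
  by rewrite deriveV // qv.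
apply: is_derive_eq (is_deriveM dp dV) _.
rewrite /GRing.scale /=; field; exact: q0.
Qed.

Lemma is_derive_bigsum (I : Type) (s : seq I) (f : I -> R -> R) (df : I -> R) (x : R) :
    (forall i, is_derive x (1 : R) (f i) (df i)) ->
  is_derive x (1 : R) (fun t => \sum_(i <- s) f i t) (\sum_(i <- s) df i).
Proof.
move=> fd; elim: s => [|i s IH].
  rewrite big_nil; have -> : (fun t => \sum_(i <- [::]) f i t) = cst 0.
    by apply/funext => t; rewrite big_nil.
  exact: is_derive_cst.
rewrite big_cons; have -> : (fun t => \sum_(j <- i :: s) f j t) =
    f i + (fun t => \sum_(j <- s) f j t).
  by apply/funext => t; rewrite big_cons.
exact: is_deriveD.
Qed.

Lemma near_all (I : eqType) (s : seq I) (P : I -> R -> Prop) (x : R) :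
    (forall i, \forall t \near x, P i t) ->
  \forall t \near x, {in s, forall i, P i t}.
Proof.
move=> Pn; elim: s => [|i s IH]; first by near=> t.
near=> t => j; rewrite inE => /predU1P[->|]; first by near: t; exact: Pn.
by move: j; near: t.
Unshelve. all: by end_near. Qed.

Lemma near_horner_neq0 (p : {poly R}) :
  p.[0] != 0 -> \forall t \near (0 : R), p.[t] != 0.
Proof.
by move=> p0; exact: (cvgr_neq0 p.[0] (@continuous_horner _ p 0)).
Qed.

End Derivatives.

(** * The moment map, and criticality from M = c + D *)

Section MomentMapComputation.
Variables (R : realType) (V : vectType R[i]) (ip : {dot V for conjC}).
Local Notation "A ^a" := (adj ip A) (at level 2, format "A ^a").
Implicit Types (A B D : 'End(V)) (mu nu : product_on V) (E F : seq V).

Section Diagonal.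
Variables (A : 'End(V)) (E : seq V) (a : V -> R).
Hypotheses (bE : orthonormal_basis ip E) (sA : A^a = A).
Hypothesis AE : {in E, forall e, A e = (a e)%:C *: e}.

Let g (t : R) : 'End(V) := \1%VF + t%:C *: A.
(** The eigenvalue of [g t] at e, kept as a polynomial in t so that [rho] becomes a sum of quotients
    of polynomials. *)
Let l (e : V) : {poly R} := 1 + (a e) *: 'X.

Let gE t e : e \in E -> g t e = (l e).[t]%:C *: e.
Proof.
move=> eE; rewrite add_lfunE id_lfunE scale_lfunE AE // !hornerE.
by rewrite rmorphD rmorph1 scalerDl scale1r scalerA rmorphM mulrC.
Qed.

Let g_dot t u e : e \in E -> ip (g t u) e = (l e).[t]%:C * ip u e.
Proof.
move=> eE; have sg : (g t)^a = g t.
  rewrite linearD linearZ /= adj_id sA; congr (_ + _ *: _).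
  exact: conjc_real.
by rewrite adjP sg gE // linearZr_LR /=; congr (_ * _); exact: conjc_real.
Qed.

Let g_inv t : {in E, forall e, (l e).[t] != 0} ->
  {in E, forall e, (g t)^-1%VF e = ((l e).[t]^-1)%:C *: e}.
Proof.
move=> lt0 e eE.
have kg : lker (g t) == 0%VS.
  rewrite -subv0; apply/subvP => x; rewrite memv_ker memv0 => /eqP gx0.
  apply/eqP/(onb_eq0 bE) => f fE; have := g_dot t x fE.
  rewrite gx0 linear0l => /esym/eqP; rewrite mulf_eq0 => /orP[|/eqP //].
  by rewrite -(rmorph0 (real_complex R)) (inj_eq (@complexI R)) (negPf (lt0 _ fE)).
have := lker0_lfunK kg e; rewrite gE // linearZ /= => ke.
transitivity (((l e).[t]^-1)%:C *: ((l e).[t]%:C *: (g t)^-1%VF e)).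
  by rewrite scalerA -rmorphM mulVf ?lt0 // scale1r.
by rewrite ke.
Qed.

Definition structure_sqnorm mu x y z : R := complex.Re (ip (mu x y) z * ip z (mu x y)).

Lemma structure_sqnormE mu x y z :
  (structure_sqnorm mu x y z)%:C = ip (mu x y) z * ip z (mu x y).
Proof. by rewrite RRe_real // ger0_real // [ip z _]dotC mul_conjC_ge0. Qed.

(* In an orthonormal eigenbasis of A, 1 + tA rescales each structure constant. *)
Let rho_near mu : \forall t \near (0 : R), rho ip mu (g t) =
  \sum_(x <- E) \sum_(y <- E) \sum_(z <- E)
    ((structure_sqnorm mu x y z *: l z ^+ 2).[t] / (l x ^+ 2 * l y ^+ 2).[t]).
Proof.
have : \forall t \near (0 : R), {in E, forall e, (l e).[t] != 0}.
  apply: near_all => e; apply: near_horner_neq0.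
  by rewrite /l !hornerE ?mulr0 ?addr0 oner_neq0.
apply: filterS => t lt0; apply: (@complexI R).
rewrite /rho -prod_sqnormE (prod_ip_onb _ _ bE) /dot_on rmorph_sum.
apply: eq_big_seq => x xE; rewrite rmorph_sum; apply: eq_big_seq => y yE.
rewrite rmorph_sum (onb_dot bE); apply: eq_big_seq => z zE /=.
have glE : gl_act (g t) mu x y =
    ((l x).[t]^-1 * (l y).[t]^-1)%:C *: g t (mu x y).
  rewrite gl_actE !g_inv // productZZ.
  by rewrite -rmorphM linearZ.
pose k := (l z).[t] / ((l x).[t] * (l y).[t]).
have kE : ip (gl_act (g t) mu x y) z = k%:C * ip (mu x y) z.
  rewrite glE linearZl_LR /= g_dot // mulrA -rmorphM /= mulrC.
  by rewrite [RHS]mulrC /k invfM [(l z).[t] * _]mulrC.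
have kE' : ip z (gl_act (g t) mu x y) = k%:C * ip z (mu x y).
  rewrite dotC kE rmorphM /= -dotC; congr (_ * _); exact: conjc_real.
rewrite kE kE' mulrACA -structure_sqnormE -!rmorphM; congr (_%:C).
rewrite hornerZ (hornerM (l x ^+ 2)) !horner_exp /k; field.
by rewrite !lt0.
Qed.

Lemma rho_derive mu : is_derive (0 : R) (1 : R) (fun t : R => rho ip mu (g t))
  (complex.Re (lftrace (Mop ip mu \o A)%VF)).
Proof.
apply: (near_eq_is_derive (f := fun t => \sum_(x <- E) \sum_(y <- E) \sum_(z <- E)
    ((structure_sqnorm mu x y z *: l z ^+ 2).[t] / (l x ^+ 2 * l y ^+ 2).[t]))).
  by apply: filterS (rho_near mu) => t ->.
have l0 e : (l e).[0] = 1 by rewrite /l !hornerE ?mulr0 ?addr0.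
have l'0 e : (l e)^`().[0] = a e.
  by rewrite /l !poly.derivE !hornerE.
(* Logarithmic derivative: every [l] is 1 at 0, so each squared factor contributes twice its slope,
   with a minus sign in the denominator. *)
have dE x y z : is_derive (0 : R) (1 : R) (fun t =>
    (structure_sqnorm mu x y z *: l z ^+ 2).[t] / (l x ^+ 2 * l y ^+ 2).[t])
    (structure_sqnorm mu x y z * (2 * (a z - a x - a y))).
  apply: is_derive_eq (is_derive_quot _ _) _.
    by rewrite hornerM !horner_exp !l0 !expr1n mulr1 oner_neq0.
  move: (l0 x) (l0 y) (l0 z) (l'0 x) (l'0 y) (l'0 z).
  move: (l x) (l y) (l z) => p q r p0 q0 r0 p1 q1 r1.
  rewrite derivZ derivM !deriv_exp !expr2 !(hornerZ, hornerM, hornerD, hornerMn).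
  rewrite /= p0 q0 r0 p1 q1 r1; by field.
have := is_derive_bigsum E (fun x => is_derive_bigsum E (fun y =>
  is_derive_bigsum E (fun z => dE x y z))).
move=> H; apply: is_derive_eq H _.
(* In the eigenbasis the infinitesimal action of [A] multiplies the structure constant at x, y, z by
   a z - a x - a y. *)
suff -> : lftrace (Mop ip mu \o A)%VF = (\sum_(x <- E) \sum_(y <- E) \sum_(z <- E)
    structure_sqnorm mu x y z * (2 * (a z - a x - a y)))%:C by [].
rewrite (Mpol_trace _ _ _ bE) /dot_on mulr_sumr rmorph_sum.
apply: eq_big_seq => x xE; rewrite mulr_sumr rmorph_sum.
apply: eq_big_seq => y yE; rewrite (onb_dot bE) mulr_sumr rmorph_sum.
apply: eq_big_seq => z zE; rewrite !linearBl /= adjP sA !AE // linearZr_LR /=.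
have cE : conjC (a z)%:C = (a z)%:C by exact: conjc_real.
rewrite productZl productZr !linearZl_LR /= cE.
rewrite rmorphM /= structure_sqnormE rmorphM !rmorphB /= rmorph_nat.
rewrite /GRing.scale /=; ring.
Qed.


End Diagonal.

Lemma op_ipZl k A B : op_ip ip (k *: A) B = k * op_ip ip A B.
Proof. by rewrite /op_ip -comp_lfunZl linearZ. Qed.

Lemma op_ipC A B : op_ip ip A B = conjC (op_ip ip B A).
Proof. by rewrite /op_ip -(lftrace_adj_conj ip) adj_comp adjK. Qed.

Lemma op_ipZr k A B : op_ip ip A (k *: B) = conjC k * op_ip ip A B.
Proof. by rewrite op_ipC op_ipZl rmorphM /= -op_ipC. Qed.

Lemma op_ipDl A B D : op_ip ip (A + B) D = op_ip ip A D + op_ip ip B D.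
Proof. by rewrite /op_ip comp_lfunDl linearD. Qed.

Lemma op_ipBl A B D : op_ip ip (A - B) D = op_ip ip A D - op_ip ip B D.
Proof. by rewrite op_ipDl -scaleN1r op_ipZl mulN1r. Qed.

Lemma op_ipDr A B D : op_ip ip A (B + D) = op_ip ip A B + op_ip ip A D.
Proof. by rewrite op_ipC op_ipDl rmorphD /= -!op_ipC. Qed.

Lemma op_ipBr A B D : op_ip ip A (B - D) = op_ip ip A B - op_ip ip A D.
Proof. by rewrite op_ipC op_ipBl rmorphB /= -!op_ipC. Qed.

Lemma op_ipNl A B : op_ip ip (- A) B = - op_ip ip A B.
Proof. by rewrite -scaleN1r op_ipZl mulN1r. Qed.

Lemma op_ipNr A B : op_ip ip A (- B) = - op_ip ip A B.
Proof. by rewrite op_ipC op_ipNl rmorphN /= -op_ipC. Qed.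

Lemma moment_mapE mu : mu != 0 ->
  moment_map ip mu = (prod_sqnorm ip mu)^-1%:C *: Mop ip mu.
Proof.
move=> mu0; have n0 := lt0r_neq0 (prod_sqnorm_gt0 ip mu0).
set m := _ *: _; have cr (r : R) : conjC r%:C = r%:C by exact: conjc_real.
have mm : is_moment ip mu m.
  split; first by rewrite /selfadjoint linearZ /= Mop_adj cr.
  move=> A sA; have [E [a [bE AE]]] := eigen_onb sA.
  apply: is_derive_eq (rho_derive bE sA AE mu) _.
  rewrite op_ipZl /op_ip sA; set w := lftrace _.
  by case: w => wr wi /=; rewrite mul0r subr0; field.
(* Uniqueness: the difference of two candidates is itself self-adjoint, hence an admissible
   direction, and testing both in it gives |y - m|^2 = 0. *)
rewrite /moment_map; apply: xget_unique => // y [sy dy]; case: mm => sm dm.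
have se : selfadjoint ip (y - m) by rewrite /selfadjoint adjB sy sm.
have := @derive_val _ _ _ _ _ _ _ (dy _ se).
rewrite (@derive_val _ _ _ _ _ _ _ (dm _ se)) => /(mulIf n0) ym.
have /op_ip_eq0 : op_ip ip (y - m) (y - m) = 0; last by move/subr0_eq.
have /complex_realP [r rE] : op_ip ip (y - m) (y - m) \is Num.real.
  by rewrite ger0_real // op_ip_ge0.
have := congr1 (@complex.Re R) rE.
by rewrite {1}op_ipBl raddfB /= ym subrr rE => <-.
Qed.

Lemma FsqE mu : mu != 0 ->
  Fsq ip mu = complex.Re (op_ip ip (Mop ip mu) (Mop ip mu)) / prod_sqnorm ip mu ^+ 2.
Proof.
move=> mu0; rewrite /Fsq moment_mapE // op_ipZl op_ipZr mulrA.
have -> : conjC ((prod_sqnorm ip mu)^-1)%:C = ((prod_sqnorm ip mu)^-1)%:C.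
  exact: conjc_real.
rewrite -rmorphM; case: (op_ip ip _ _) => wr wi /=; rewrite mul0r subr0.
by rewrite mulrC expr2 invfM.
Qed.

Lemma productP (a : R[i]) mu mu' x y :
  (a *: mu + mu') x y = a *: mu x y + mu' x y.
Proof. by rewrite add_lfunE scale_lfunE add_lfunE scale_lfunE. Qed.

Lemma MpolPl (a : R[i]) mu mu' nu :
  Mpol ip (a *: mu + mu') nu = a *: Mpol ip mu nu + Mpol ip mu' nu.
Proof.
apply/lfunP => u; apply: (dot_inj (ip := ip)) => v.
rewrite dotC [RHS]dotC; congr (conjC _).
rewrite [in RHS]add_lfunE [in RHS]scale_lfunE linearPl /= !(Mpol_dot _ _ _ _ (onbP ip)).
set E := onb ip.
have -> : \sum_(x <- E) \sum_(y <- E) ip u (nu x y) * ip ((a *: mu + mu') x y) v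
    = a * (\sum_(x <- E) \sum_(y <- E) ip u (nu x y) * ip (mu x y) v) +
      \sum_(x <- E) \sum_(y <- E) ip u (nu x y) * ip (mu' x y) v.
  rewrite mulr_sumr -big_split; apply: eq_bigr => x _ /=.
  rewrite mulr_sumr -big_split; apply: eq_bigr => y _ /=.
  by rewrite productP linearPl /=; ring.
have -> : \sum_(x <- E) ip ((a *: mu + mu') x u) (nu x v)
    = a * (\sum_(x <- E) ip (mu x u) (nu x v)) + \sum_(x <- E) ip (mu' x u) (nu x v).
  rewrite mulr_sumr -big_split; apply: eq_bigr => x _ /=.
  by rewrite productP linearPl.
have -> : \sum_(x <- E) ip ((a *: mu + mu') u x) (nu v x)
    = a * (\sum_(x <- E) ip (mu u x) (nu v x)) + \sum_(x <- E) ip (mu' u x) (nu v x).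
  rewrite mulr_sumr -big_split; apply: eq_bigr => x _ /=.
  by rewrite productP linearPl.
by ring.
Qed.

Lemma MpolPr (a : R[i]) mu nu nu' :
  Mpol ip mu (a *: nu + nu') = conjC a *: Mpol ip mu nu + Mpol ip mu nu'.
Proof. by rewrite -Mpol_adj MpolPl adjPlin !Mpol_adj. Qed.

Lemma prod_ipPl (a : R[i]) mu mu' nu :
  prod_ip ip (a *: mu + mu') nu = a * prod_ip ip mu nu + prod_ip ip mu' nu.
Proof.
rewrite !(prod_ip_onb _ _ (onbP ip)) mulr_sumr -big_split; apply: eq_bigr => x _ /=.
rewrite mulr_sumr -big_split; apply: eq_bigr => y _ /=.
by rewrite productP linearPl.
Qed.

Lemma prod_ipC mu nu : prod_ip ip mu nu = conjC (prod_ip ip nu mu).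
Proof.
rewrite !(prod_ip_onb _ _ (onbP ip)) rmorph_sum; apply: eq_bigr => x _ /=.
by rewrite rmorph_sum; apply: eq_bigr => y _ /=; rewrite -dotC.
Qed.

Lemma prod_ipPr (a : R[i]) mu nu nu' :
  prod_ip ip mu (a *: nu + nu') = conjC a * prod_ip ip mu nu + prod_ip ip mu nu'.
Proof. by rewrite prod_ipC prod_ipPl rmorphD rmorphM /= -!prod_ipC. Qed.

(** Criticality only sees the value and the slope at 0; the higher coefficients stay hidden in
    [cs]. *)
Lemma op_ip_quadratic A B D : exists cs : seq R, forall t,
  complex.Re (op_ip ip (A + t%:C *: B + (t ^+ 2)%:C *: D)
                       (A + t%:C *: B + (t ^+ 2)%:C *: D)) =
  (\poly_(i < 5) [:: complex.Re (op_ip ip A A),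
                     2 * complex.Re (op_ip ip A B) & cs]`_i).[t].
Proof.
exists [:: complex.Re (op_ip ip B B) + 2 * complex.Re (op_ip ip A D);
  2 * complex.Re (op_ip ip B D); complex.Re (op_ip ip D D)] => t.
rewrite !op_ipDl !op_ipDr !op_ipZl !op_ipZr.
have cr (r : R) : conjC r%:C = r%:C by exact: conjc_real.
rewrite !cr (op_ipC B A) (op_ipC D A) (op_ipC D B).
rewrite horner_poly !big_ord_recl big_ord0 /=.
case: (op_ip ip A A) (op_ip ip A B) (op_ip ip A D) (op_ip ip B B)
  (op_ip ip B D) (op_ip ip D D).
move=> a0 b0 [a1 b1] [a2 b2] [a3 b3] [a4 b4] [a5 b5] /=; ring.
Qed.

Lemma Mop_Mpol mu : Mop ip mu = Mpol ip mu mu.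
Proof. by []. Qed.

Section Line.
Variables (mu nu : product_on V).
Let r := complex.Re (prod_ip ip mu nu).
Let M0 := Mop ip mu.
Let M1 := Mpol ip mu nu + Mpol ip nu mu.
Let M2 := Mop ip nu.

Lemma prod_sqnorm_line t : prod_sqnorm ip (mu + t%:C *: nu) =
  (\poly_(i < 3) [:: prod_sqnorm ip mu; 2 * r; prod_sqnorm ip nu]`_i).[t].
Proof.
rewrite /prod_sqnorm addrC prod_ipPl !prod_ipPr [prod_ip ip nu mu]prod_ipC.
have -> : conjC t%:C = t%:C by exact: conjc_real.
rewrite horner_poly !big_ord_recl big_ord0 /= /r.
case: (prod_ip ip mu mu) (prod_ip ip mu nu) (prod_ip ip nu nu).
move=> a0 b0 [a1 b1] [a2 b2] /=; ring.
Qed.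

Lemma Mop_line t : Mop ip (mu + t%:C *: nu) = M0 + t%:C *: M1 + (t ^+ 2)%:C *: M2.
Proof.
rewrite /M0 /M1 /M2 !Mop_Mpol addrC MpolPl !MpolPr.
have -> : conjC t%:C = t%:C by exact: conjc_real.
move: (Mpol ip mu mu) (Mpol ip mu nu) (Mpol ip nu mu) (Mpol ip nu nu) => A B C D.
rewrite !scalerDr scalerA -rmorphM -expr2 addrC [_ *: B + A]addrC.
by rewrite [_ *: D + _]addrC !addrA.
Qed.

Lemma op_ip_Mop_line : exists cs : seq R, forall t,
  complex.Re (op_ip ip (Mop ip (mu + t%:C *: nu)) (Mop ip (mu + t%:C *: nu))) =
  (\poly_(i < 5) [:: complex.Re (op_ip ip M0 M0),
                     2 * complex.Re (op_ip ip M0 M1) & cs]`_i).[t].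
Proof.
have [cs csP] := op_ip_quadratic M0 M1 M2.
by exists cs => t; rewrite Mop_line csP.
Qed.

(** The two halves of [M1] are adjoint to each other, so their products with the self-adjoint [M0]
    have the same real part, - 2cr each. *)
Lemma op_ip_Mop_polar (c : R) D : Mop_decomposition ip mu c D ->
  complex.Re (op_ip ip M0 M1) = - (4 * c * r).
Proof.
move=> MD; rewrite op_ipDr [op_ip ip M0 (Mpol ip mu nu)]op_ipC.
have e : op_ip ip (Mpol ip mu nu) M0 = - (2 * c)%:C * prod_ip ip mu nu.
  by rewrite /op_ip Mop_adj (Mpol_decomposition MD).
have -> : op_ip ip M0 (Mpol ip nu mu) = op_ip ip (Mpol ip mu nu) M0.
  by rewrite /op_ip Mpol_adj Mop_adj lftraceC.
rewrite e /r; case: (prod_ip ip mu nu) => x y /=; ring.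
Qed.

(** The squared norm along the line is a polynomial that is positive at 0. The closed formula for F
    is only available off the zero product. *)
Lemma line_neq0 : mu != 0 -> \forall t \near (0 : R), mu + t%:C *: nu != 0.
Proof.
move=> mu0; have : (\poly_(i < 3) [:: prod_sqnorm ip mu; 2 * r;
                               prod_sqnorm ip nu]`_i).[0] != 0.
  by rewrite -prod_sqnorm_line rmorph0 scale0r addr0 gt_eqF // prod_sqnorm_gt0.
move/near_horner_neq0; apply: filterS => t; rewrite -prod_sqnorm_line.
apply: contra_neq => ->.
by rewrite /prod_sqnorm (prod_ip_onb _ _ (onbP ip)) /dot_on big1 // => x _;
  rewrite big1 // => y _; rewrite !zero_lfunE linear0l.
Qed.

End Line.

Lemma decomposition_critical mu (c : R) D : mu != 0 ->
  Mop_decomposition ip mu c D -> critical ip mu.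
Proof.
move=> mu0 MD; split=> // nu.
have [cs Pt] := op_ip_Mop_line mu nu.
set p := \poly_(i < 5) _ in Pt.
pose q := \poly_(i < 3) [:: prod_sqnorm ip mu; 2 * complex.Re (prod_ip ip mu nu);
                           prod_sqnorm ip nu]`_i.
have n0 := lt0r_neq0 (prod_sqnorm_gt0 ip mu0).
have q0 : q.[0] = prod_sqnorm ip mu by rewrite horner_coef0 coef_poly.
have q1 : q^`().[0] = 2 * complex.Re (prod_ip ip mu nu).
  by rewrite horner_coef0 coef_deriv coef_poly mulr1n.
have p0 : p.[0] = - (2 * c * prod_sqnorm ip mu).
  by rewrite horner_coef0 coef_poly /= (op_ip_Mop MD).
have p1 : p^`().[0] = - (8 * c * complex.Re (prod_ip ip mu nu)).
  rewrite horner_coef0 coef_deriv coef_poly mulr1n /= (op_ip_Mop_polar nu MD); ring.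
apply: (near_eq_is_derive (f := fun t => p.[t] / (q ^+ 2).[t])).
  apply: filterS (line_neq0 nu mu0) => t t0.
  by rewrite FsqE // Pt prod_sqnorm_line horner_exp.
apply: is_derive_eq (is_derive_quot _ _) _.
  by rewrite horner_exp q0 expf_neq0.
(* With n = |mu|^2 and r the real part of the product of mu and nu, the numerator is - 8cr n^2 + 2cn
   (4nr) = 0. *)
rewrite horner_exp deriv_exp !(hornerMn, hornerM) expr1 p0 p1 q0 q1; by field.
Qed.

End MomentMapComputation.

(** * Commutators under the trace form, and normal operators *)

Section OperatorLemmas.
Variables (R : realType) (V : vectType R[i]) (ip : {dot V for conjC}).
Local Notation "A ^a" := (adj ip A) (at level 2, format "A ^a").
Implicit Types (A P S T : 'End(V)).

Lemma dot_injl u v : (forall x, ip u x = ip v x) -> u = v.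
Proof. by move=> uv; apply: (dot_inj (ip := ip)) => x; rewrite dotC uv -dotC. Qed.

(** Completing [E] to a basis can add nothing: an added vector would be orthogonal to [E], hence
    zero. *)
Lemma orthonormal_basisP (E : seq V) : orthonormal ip E ->
  (forall u, {in E, forall e, ip u e = 0} -> u = 0) -> orthonormal_basis ip E.
Proof.
move=> oE E0; have [[|f F] //] := orthonormal_extend oE.
case=> _; rewrite orthonormal_cat => /and3P[oF _ oFE].
have f0 : f = 0.
  apply: E0 => e eE; apply/eqP; move/allP: oFE => /(_ f (mem_head _ _)) /=.
  by move/allP/(_ e eE).
by have := orthonormal_not0 oF; rewrite f0 mem_head.
Qed.

Lemma skew_commutator_dot P S T : P^a = - P ->
  op_ip ip ((P \o S) - (S \o P))%VF T = - op_ip ip S ((P \o T) - (T \o P))%VF.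
Proof.
move=> Pa; rewrite op_ipBl.
have -> : op_ip ip (P \o S)%VF T = - op_ip ip S (P \o T)%VF.
  rewrite /op_ip adj_comp Pa !comp_lfunNr lftraceN opprK.
  by rewrite -comp_lfunA lftraceC -comp_lfunA.
have -> : op_ip ip (S \o P)%VF T = - op_ip ip S (T \o P)%VF.
  by rewrite /op_ip adj_comp Pa comp_lfunNl comp_lfunNr lftraceN opprK comp_lfunA.
by rewrite op_ipBr opprB opprK addrC.
Qed.

(** Bracketing with a self-adjoint [P] is self-adjoint for the trace form, so its image is
    orthogonal to its kernel, the commutant of [P]. *)
Lemma commutator_dot_eq0 P S T : P^a = P -> (P \o S)%VF = (S \o P)%VF ->
  op_ip ip S ((P \o T) - (T \o P))%VF = 0.
Proof.
move=> Pa PS; rewrite /op_ip adjB !adj_comp Pa comp_lfunDr comp_lfunNr lftraceB.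
have -> : lftrace (S \o (T^a \o P))%VF = lftrace (S \o (P \o T^a))%VF.
  by rewrite [in LHS]comp_lfunA [LHS]lftraceC [in LHS]comp_lfunA PS -comp_lfunA.
by rewrite subrr.
Qed.

(** On skew operators the form is - tr ST, which is symmetric as well as Hermitian. *)
Lemma skew_dot_real S T : S^a = - S -> T^a = - T -> op_ip ip S T \is Num.real.
Proof.
move=> Sa Ta; apply/CrealP; rewrite -op_ipC /op_ip Sa Ta.
by rewrite !comp_lfunNr !linearN /= lftraceC.
Qed.

Lemma normal_op_dot T x y : normal_op ip T -> ip (T^a x) (T^a y) = ip (T x) (T y).
Proof.
move=> nT; rewrite adjP adjK adjP; congr (ip _ _).
by have := congr1 (fun f : 'End(V) => f y) nT; rewrite !comp_lfunE.
Qed.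

Lemma skew_normal T : T^a = - T -> normal_op ip T.
Proof. by move=> Ta; rewrite /normal_op Ta comp_lfunNr comp_lfunNl. Qed.

End OperatorLemmas.

(** * Orthogonal direct sums *)

Section ProductDot.
Variables (R : realType) (U W : vectType R[i]).
Variables (ipU : {dot U for conjC}) (ipW : {dot W for conjC}).

Lemma product_dot_ex : exists ip : {dot (U * W)%type for conjC},
  forall a b x y, ip (a, x) (b, y) = ipU a b + ipW x y.
Proof.
have [|||ip ipE] := @dot_of_form R (U * W)%type
  (fun p q => ipU p.1 q.1 + ipW p.2 q.2).
- by move=> w a u v /=; rewrite !linearPl /= mulrDr addrACA.
- by move=> u v; rewrite rmorphD /= -!dotC.
- move=> [a x] /= ax0; rewrite lt_def addr_ge0 ?dnorm_ge0 // andbT.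
  rewrite paddr_eq0 ?dnorm_ge0 // !dnorm_eq0; apply: contra_neqN ax0.
  by move=> /andP[/eqP -> /eqP ->].
by exists ip.
Qed.

Variables (V : vectType R[i]) (j : U -> W -> V).
Hypothesis j_surj : forall v, exists a x, v = j a x.
Variable ip : {dot V for conjC}.
Hypothesis ipE : forall a b x y, ip (j a x) (j b y) = ipU a b + ipW x y.

Lemma product_onb (E : seq U) (F : seq W) :
    orthonormal_basis ipU E -> orthonormal_basis ipW F ->
  orthonormal_basis ip ([seq j a 0 | a <- E] ++ [seq j 0 x | x <- F]).
Proof.
move=> bE bF; have [/orthonormalP[uE oE] /orthonormalP[uF oF]] := (bE.2, bF.2).
have jE a b : a \in E -> b \in E -> ip (j a 0) (j b 0) = (a == b)%:R.
  by move=> aE bE'; rewrite ipE linear0l addr0 oE.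
have jF x y : x \in F -> y \in F -> ip (j 0 x) (j 0 y) = (x == y)%:R.
  by move=> xF yF; rewrite ipE linear0l add0r oF.
have inj01 (b b' : bool) : (b%:R = b'%:R :> R[i]) -> b = b'.
  by move/eqP; rewrite eqr_nat; case: b b' => [] [].
have jEI : {in E &, injective (j^~ 0)}.
  move=> a b aE bE' jab; apply/eqP; have := jE a b aE bE'.
  by rewrite jab jE // eqxx => /inj01 <-.
have jFI : {in F &, injective (j 0)}.
  move=> a b aE bE' jab; apply/eqP; have := jF a b aE bE'.
  by rewrite jab jF // eqxx => /inj01 <-.
apply: orthonormal_basisP => [|v v0]; last first.
  have [a [x ve]] := j_surj v; rewrite {v}ve in v0 *.
  suff [-> ->] : a = 0 /\ x = 0.
    by apply/eqP; rewrite -(dnorm_eq0 ip) ipE !linear0l addr0.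
  split.
    apply: (onb_eq0 bE) => e eE; have := v0 (j e 0).
    by rewrite ipE linear0r addr0; apply; rewrite mem_cat (map_f (j^~ 0)).
  apply: (onb_eq0 bF) => e eF; have := v0 (j 0 e).
  by rewrite ipE linear0r add0r; apply; rewrite mem_cat (map_f (j 0)) ?orbT.
rewrite orthonormal_cat; apply/and3P; split.
- apply/orthonormalP; split; first by rewrite map_inj_in_uniq.
  move=> _ _ /mapP[a aE ->] /mapP[b bE' ->].
  by rewrite jE // (inj_in_eq jEI).
- apply/orthonormalP; split; first by rewrite map_inj_in_uniq.
  move=> _ _ /mapP[a aE ->] /mapP[b bE' ->].
  by rewrite jF // (inj_in_eq jFI).
- apply/allP => _ /mapP[a aE ->]; apply/allP => _ /mapP[b bF' ->] /=.
  by rewrite ipE linear0r linear0l addr0.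
Qed.

End ProductDot.

(** * The extension of lambda by f: the new inner product and M of mu *)

Section Extension.
(* j identifies V with U x W.  V is kept abstract because on the pair type
   unification unfolds the vector space structure. *)
Variables (R : realType) (U W V : vectType R[i]) (j : U -> W -> V).
Hypotheses (j_lin : forall k a b x y,
    j (k *: a + b) (k *: x + y) = k *: j a x + j b y)
  (j_inj : forall a b x y, j a x = j b y -> a = b /\ x = y)
  (j_surj : forall v, exists a x, v = j a x).
Variables (ad : product_on U) (h z : {vspace U}) (fP : reductive ad h z).
Variables (ip : {dot W for conjC}) (lambda : product_on W) (c : R) (D : 'End(W)).
Hypotheses (MlambdaE : Mop_decomposition ip lambda c D) (c_lt0 : c < 0).
Hypothesis D_inj : lker D == 0%VS.
Variables (L Rr : 'Hom(U, 'End(W))) (mu : product_on V).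
Hypothesis muE : forall A B X Y,
  mu (j A X) (j B Y) = j (ad A B) (L A Y + Rr B X + lambda X Y).
Hypothesis mu_leibniz : symmetric_leibniz mu.
Hypotheses (DL : forall A, (D \o L A = L A \o D)%VF)
  (DR : forall A, (D \o Rr A = Rr A \o D)%VF).
Hypotheses (Lnormal : forall Z, Z \in z -> normal_op ip (L Z))
  (Rnormal : forall Z, Z \in z -> normal_op ip (Rr Z))
  (LR_neq0 : forall Z, Z \in z -> Z != 0 -> L Z != 0 \/ Rr Z != 0).
Variables (ip1 : {dot U for conjC}) (Hs Zs : seq U).
Hypotheses (Hs_h : {in Hs, forall H, H \in h}) (Zs_z : {in Zs, forall Z, Z \in z}).
Hypothesis HZ_full : <<Hs ++ Zs>>%VS = fullv.
Hypotheses (ad_skew : {in Hs, forall H, adj ip1 (ad H) = - ad H})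
  (L_skew : {in Hs, forall H, adj ip (L H) = - L H})
  (R_skew : {in Hs, forall H, adj ip (Rr H) = - Rr H}).

Lemma ad_anti A B : ad A B = - ad B A.
Proof.
have [[alt _] _ _ _ _] := fP; apply/eqP; rewrite -addr_eq0.
have := alt (A + B); rewrite productDl !productDr !alt add0r addr0.
by move=> ->.
Qed.

Lemma ad_center A : A \in z <-> ad A = 0.
Proof.
have [_ _ _ zP _] := fP; split=> [/zP A0|A0].
  by apply/lfunP => B; rewrite A0 zero_lfunE.
by apply/zP => B; rewrite A0 zero_lfunE.
Qed.

Lemma ad_bracket A B : ad (ad A B) = ((ad A \o ad B) - (ad B \o ad A))%VF.
Proof.
have [[_ jac] _ _ _ _] := fP; apply/lfunP => x.
rewrite add_lfunE opp_lfunE !comp_lfunE.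
have /eqP := jac A B x; rewrite addr_eq0 [ad (ad A B) x]ad_anti => /eqP <-.
by rewrite [ad x A]ad_anti productNr.
Qed.

Lemma jD a b x y : j a x + j b y = j (a + b) (x + y).
Proof. by have := j_lin 1 a b x y; rewrite !scale1r. Qed.

Lemma jZ k a x : k *: j a x = j (k *: a) (k *: x).
Proof.
have j00 : j 0 0 = 0.
  by apply: (addrI (j 0 0)); rewrite jD !addr0.
by have := j_lin k a 0 x 0; rewrite j00 !addr0.
Qed.

Lemma j_eq0 a x : j a x = 0 -> a = 0 /\ x = 0.
Proof.
have j00 : j 0 0 = 0 by have := jZ 0 0 0; rewrite !scale0r.
by rewrite -j00; exact: j_inj.
Qed.

Lemma ext_neq0 : lambda != 0 -> mu != 0.
Proof.
apply: contra_neq => mu0; apply/lfunP => X; apply/lfunP => Y.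
have := muE 0 0 X Y; rewrite mu0 !zero_lfunE !linear0 !zero_lfunE !add0r.
by move/esym/j_eq0 => [].
Qed.

Lemma L_bracket A B : L (ad A B) = ((L A \o L B) - (L B \o L A))%VF.
Proof.
apply/lfunP => Y; rewrite add_lfunE opp_lfunE !comp_lfunE.
have [+ _] := mu_leibniz (j A 0) (j B 0) (j 0 Y).
rewrite !muE jD => /j_inj[_].
rewrite !(linear0, zero_lfunE, addr0, add0r) => ->.
by rewrite addrK.
Qed.

(** The second Leibniz identity with the element of [W] in the first slot; right multiplications
    compose in reverse, so [Rr] is an anti-representation. *)
Lemma R_bracket A B : Rr (ad A B) = ((Rr B \o Rr A) - (Rr A \o Rr B))%VF.
Proof.
apply/lfunP => Y; rewrite add_lfunE opp_lfunE !comp_lfunE.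
have [_ +] := mu_leibniz (j 0 Y) (j A 0) (j B 0).
rewrite !muE jD => /j_inj[_].
rewrite !(linear0, zero_lfunE, addr0, add0r) => ->.
by rewrite addrC addKr.
Qed.

Definition ext_trace A B : R[i] :=
  op_ip ip1 (ad A) (ad B) + op_ip ip (L A) (L B) + op_ip ip (Rr A) (Rr B).

(** If the [ad] term vanishes then A is central, and there [L] or [Rr] is nonzero by condition
    (ii). *)
Lemma ext_trace_gt0 A : A != 0 -> 0 < ext_trace A A.
Proof.
move=> A0; rewrite lt_def !addr_ge0 ?op_ip_ge0 // andbT.
rewrite !paddr_eq0 ?addr_ge0 ?op_ip_ge0 //.
apply/negP => /andP[/andP[/eqP /op_ip_eq0 ad0 /eqP /op_ip_eq0 L0]].
move=> /eqP /op_ip_eq0 R0.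
by case: (LR_neq0 _ A0) => [|/eqP|/eqP] //; apply/ad_center.
Qed.

Lemma ext_dot_ex : exists ipf : {dot U for conjC},
  forall A B, ipf A B = - (2 / c)%:C * ext_trace A B.
Proof.
have k0 : 0 < - (2 / c)%:C.
  by rewrite oppr_gt0 ltcR pmulr_rlt0 ?invr_lt0.
have [|||ipf ipfE] := @dot_of_form R U (fun A B => - (2 / c)%:C * ext_trace A B).
- move=> B a A A'; rewrite /ext_trace !linearP /= !op_ipDl !op_ipZl; ring.
- move=> A B; have kr : conjC (- (2 / c)%:C) = - (2 / c)%:C.
    by apply/CrealP; rewrite ger0_real // ltW.
  move: (- (2 / c)%:C) kr => k kr.
  by rewrite rmorphM /= kr /ext_trace !rmorphD /= -!op_ipC.
- by move=> A A0; rewrite mulr_gt0 ?ext_trace_gt0.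
by exists ipf.
Qed.

Variable ipf : {dot U for conjC}.
Hypothesis ipfE : forall A B, ipf A B = - (2 / c)%:C * ext_trace A B.

Definition acts_skew A : Prop :=
  [/\ adj ip1 (ad A) = - ad A, adj ip (L A) = - L A & adj ip (Rr A) = - Rr A].

(** [ad], [L] and [Rr] carry [ad H] to the commutator with a skew operator, which is skew for the
    trace form. The opposite sign for [Rr] enters on both sides and is harmless. *)
Lemma acts_skew_dot H A B : acts_skew H -> ipf (ad H A) B = - ipf A (ad H B).
Proof.
case=> Ha HL HR; rewrite !ipfE -mulrN; congr (_ * _).
have eR X : Rr (ad H X) = - ((Rr H \o Rr X) - (Rr X \o Rr H))%VF.
  by rewrite R_bracket opprB.
rewrite /ext_trace !ad_bracket !L_bracket !eR op_ipNl op_ipNr.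
by rewrite !skew_commutator_dot // opprK !opprD opprK.
Qed.

Lemma adj_skew H : acts_skew H -> adj ipf (ad H) = - ad H.
Proof.
move=> sH; apply: adj_unique => x y.
by rewrite acts_skew_dot // opp_lfunE linearNr.
Qed.

Lemma acts_skewP (a : R[i]) A B : a \is Num.real ->
  acts_skew A -> acts_skew B -> acts_skew (a *: A + B).
Proof.
move=> /CrealP ar [Aa AL AR] [Ba BL BR]; split; rewrite linearP /= adjPlin ar.
- by rewrite Aa Ba scalerN -opprD.
- by rewrite AL BL scalerN -opprD.
- by rewrite AR BR scalerN -opprD.
Qed.

Lemma acts_skew_real A B : acts_skew A -> acts_skew B -> ipf A B \is Num.real.
Proof.
case=> Aa AL AR [Ba BL BR]; rewrite ipfE rpredM //; last first.
  by rewrite !rpredD // skew_dot_real.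
by rewrite rpredN; apply/complex_realP; exists (2 / c).
Qed.

(** When an element of [h] is split along [Hs] and [Zs], the second part lies in both [h] and [z],
    hence is zero. *)
Lemma Hs_span : <<Hs>>%VS = h.
Proof.
have [_ _ _ _ [_ hz0]] := fP.
apply/eqP; rewrite eqEsubv; apply/andP; split; first exact/span_subvP.
apply/subvP => v vh; have : v \in <<Hs ++ Zs>>%VS by rewrite HZ_full memvf.
rewrite span_cat => /memv_addP[a aH [b bZ ve]].
have ah : a \in h by move/span_subvP: Hs_h => /subvP /(_ _ aH).
have bz : b \in z by move/span_subvP: Zs_z => /subvP /(_ _ bZ).
suff b0 : b = 0 by rewrite ve b0 addr0.
apply/eqP; rewrite -memv0 -hz0 memv_cap bz andbT.
by rewrite -(addKr a b) -ve memvD ?memvN.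
Qed.

(* Skew elements have real inner products, so Gram-Schmidt on Hs stays inside
   them; by invariance of ipf the orthogonal of h is central. *)
Lemma adapted_onb : exists E : seq U, orthonormal_basis ipf E /\
  {in E, forall A, acts_skew A \/ A \in z}.
Proof.
have skew0 : acts_skew 0.
  by split; rewrite linear0 (linear0 (adj _)) oppr0.
have PHs : {in Hs, forall H, acts_skew H}.
  by move=> H HH; split; [exact: ad_skew|exact: L_skew|exact: R_skew].
have [||//||F [oF PF sF]] := @gram_schmidt _ _ ipf acts_skew [::] Hs _ _ _ _ PHs.
- move=> G u su sG; rewrite -sumrN addrC; elim: G sG => [|e G IH] sG.
    by rewrite big_nil add0r.
  rewrite big_cons -addrA -scaleNr; apply: acts_skewP.
  + by rewrite rpredN; apply: acts_skew_real => //; apply: sG; rewrite mem_head.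
  + by apply: sG; rewrite mem_head.
  + by apply: IH => x xG; apply: sG; rewrite inE xG orbT.
- move=> u su; rewrite -[_ *: _]addr0; apply: acts_skewP => //.
  by rewrite ger0_real // invr_ge0 sqrt_dnorm_ge0.
- by [].
move: oF sF; rewrite !cats0 => oF sF.
have [G bG] := orthonormal_extend oF; exists (G ++ F); split=> // A.
rewrite mem_cat => /orP[AG|/PF]; [right|by left].
have AF v : v \in h -> ipf A v = 0.
  rewrite -Hs_span -sF => vF; apply: (@span_orthogonal _ _ ipf [:: A] F) => //.
    move: bG.2; rewrite orthonormal_cat => /and3P[_ _ /allP /(_ _ AG) /allP GF].
    by rewrite /orthogonal /= andbT; apply/allP => f /GF.
  by rewrite memv_span ?mem_head.
have [_ [_ ideal_h] _ _ _] := fP.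
(* Invariance moves [ad H] onto y, and [H, y] lies in the ideal [h], to which A is orthogonal. *)
have adH0 H : H \in Hs -> ad H A = 0.
  move=> HH; apply: (dot_injl (ip := ipf)) => y; rewrite linear0l.
  rewrite acts_skew_dot ?AF ?oppr0 //; last exact: PHs.
  by rewrite ad_anti memvN ideal_h ?memvf // Hs_h.
apply/ad_center; apply/lfunP => y; rewrite zero_lfunE ad_anti.
suff : y \in lker (rmult ad A).
  by rewrite memv_ker rmultE => /eqP ->; rewrite oppr0.
have : y \in <<Hs ++ Zs>>%VS by rewrite HZ_full memvf.
apply: subvP; apply/span_subvP => x; rewrite mem_cat memv_ker rmultE.
move=> /orP[/adH0 ->//|/Zs_z /ad_center ->]; by rewrite zero_lfunE.
Qed.

(* Both adjoints are - ad A on skew elements and vanish on the center. *)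
Lemma adj_adE A : adj ipf (ad A) = adj ip1 (ad A).
Proof.
have [E [bE EP]] := adapted_onb; rewrite (onb_sum bE A) linear_sum.
rewrite !(linear_sum (adj _)) big_seq [RHS]big_seq /=; apply: eq_bigr => e eE.
rewrite [ad _]linearZ /= !adjZ; congr (_ *: _).
case: (EP e eE) => [se|/ad_center ->]; last by rewrite !(linear0 (adj _)).
by rewrite adj_skew //; case: se.
Qed.

Lemma normal_ad A : acts_skew A \/ A \in z -> normal_op ipf (ad A).
Proof.
case=> [/adj_skew/skew_normal //|/ad_center ->].
by rewrite /normal_op (linear0 (adj _)).
Qed.

Lemma normal_L A : acts_skew A \/ A \in z -> normal_op ip (L A).
Proof. by case=> [[_ LA _]|/Lnormal //]; exact: skew_normal. Qed.

Lemma normal_R A : acts_skew A \/ A \in z -> normal_op ip (Rr A).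
Proof. by case=> [[_ _ RA]|/Rnormal //]; exact: skew_normal. Qed.

Lemma D_adj : adj ip D = D.
Proof.
have [ME _] := MlambdaE; have := Mop_adj ip lambda.
rewrite ME adjPlin adj_id => DE; apply: (addrI (c%:C *: \1%VF)); rewrite -[RHS]DE.
by congr (_ *: _ + _); apply/esym; exact: conjc_real.
Qed.

Lemma D_surj X : exists Y, X = D Y.
Proof. by exists (D^-1%VF X); rewrite lker0_lfunVK. Qed.

Lemma lambda_D Y : lambda (D Y) = ((D \o lambda Y) - (lambda Y \o D))%VF.
Proof.
have [_ dD] := MlambdaE; apply/lfunP => X.
by rewrite add_lfunE opp_lfunE !comp_lfunE dD addrK.
Qed.

Lemma rmult_lambda_D Y :
  rmult lambda (D Y) = ((D \o rmult lambda Y) - (rmult lambda Y \o D))%VF.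
Proof.
have [_ dD] := MlambdaE; apply/lfunP => X.
by rewrite add_lfunE opp_lfunE !comp_lfunE !rmultE dD addrC addKr.
Qed.

(* lambda_(DY) = [D, lambda_Y] is orthogonal to the commutant of D, and every
   vector is of the form DY. *)
Lemma L_lambda_orth A Y : op_ip ip (L A) (lambda Y) = 0.
Proof.
have [Y' ->] := D_surj Y.
by rewrite lambda_D (commutator_dot_eq0 _ D_adj).
Qed.

Lemma R_lambda_orth A Y : op_ip ip (Rr A) (rmult lambda Y) = 0.
Proof.
have [Y' ->] := D_surj Y.
by rewrite rmult_lambda_D (commutator_dot_eq0 _ D_adj).
Qed.

Variable ipe : {dot V for conjC}.
Hypothesis ipeE : forall A B X Y, ipe (j A X) (j B Y) = ipf A B + ip X Y.

Let mu_f a B Y : mu (j a 0) (j B Y) = j (ad a B) (L a Y).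
Proof. by rewrite muE !linear0 !zero_lfunE !addr0. Qed.

Let mu_W x B Y : mu (j 0 x) (j B Y) = j 0 (Rr B x + lambda x Y).
Proof. by rewrite muE !linear0 !zero_lfunE add0r. Qed.

Let muf_ A X b : mu (j A X) (j b 0) = j (ad A b) (Rr b X).
Proof. by rewrite muE !linear0 add0r addr0. Qed.

Let muW_ A X y : mu (j A X) (j 0 y) = j 0 (L A y + lambda X y).
Proof. by rewrite muE !linear0 !zero_lfunE addr0. Qed.

Lemma Mop_ext A X : Mop ipe mu (j A X) = j (c%:C *: A) (c%:C *: X + D X).
Proof.
have [E [bE EP]] := adapted_onb; have bF := onbP ip; set F := onb ip in bF.
have bP := product_onb j_surj ipeE bE bF; set P := _ ++ _ in bP.
have sumP (G : V -> R[i]) :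
    \sum_(p <- P) G p = \sum_(a <- E) G (j a 0) + \sum_(x <- F) G (j 0 x).
  by rewrite big_cat !big_map.
apply: (dot_injl (ip := ipe)) => v; have [B [Y ->]] := j_surj v.
(* Parseval yields products of adjoints of [ad a], [L a], [Rr a]; normality on the adapted basis
   removes the adjoints, so that these sums match those in [S2] and [S3]. *)
have S1 : \sum_(p <- P) \sum_(q <- P) ipe (j A X) (mu p q) * ipe (mu p q) (j B Y) =
    \sum_(a <- E) ipf (ad a A) (ad a B) + \sum_(a <- E) ip (L a X) (L a Y) +
    \sum_(a <- E) ip (Rr a X) (Rr a Y) +
    \sum_(x <- F) \sum_(y <- F) ip X (lambda x y) * ip (lambda x y) Y.
  rewrite sumP -addrA; congr (_ + _).
    rewrite -big_split /=; apply: eq_big_seq => a aE; rewrite sumP; congr (_ + _).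
      rewrite -(normal_op_dot _ _ (normal_ad (EP a aE))) -(onb_adj_dot _ _ _ _ bE).
      by apply: eq_bigr => b _; rewrite mu_f !ipeE !linear0 !linear0l !addr0.
    rewrite -(normal_op_dot _ _ (normal_L (EP a aE))) -(onb_adj_dot _ _ _ _ bF).
    by apply: eq_bigr => b _; rewrite mu_f !ipeE !linear0 !linear0l !add0r.
  under eq_bigr do rewrite sumP.
  rewrite big_split /=; congr (_ + _).
    rewrite exchange_big /=; apply: eq_big_seq => a aE.
    rewrite -(normal_op_dot _ _ (normal_R (EP a aE))) -(onb_adj_dot _ _ _ _ bF).
    by apply: eq_bigr => x _; rewrite mu_W !ipeE !linear0 !linear0l !addr0 !add0r.
  apply: eq_bigr => x _; apply: eq_bigr => y _.
  by rewrite mu_W !ipeE !linear0 !linear0l !zero_lfunE !add0r.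
have S2 : \sum_(p <- P) ipe (mu p (j A X)) (mu p (j B Y)) =
    \sum_(a <- E) ipf (ad a A) (ad a B) + \sum_(a <- E) ip (L a X) (L a Y) +
    op_ip ip (Rr A) (Rr B) + \sum_(x <- F) ip (lambda x X) (lambda x Y).
  rewrite sumP -addrA; congr (_ + _).
    by rewrite -big_split /=; apply: eq_bigr => a _; rewrite !mu_f ipeE.
  (* Right multiplication by [j A X] on the copy of [W]; the orthogonality of [Rr] to right
     multiplications of lambda removes the cross terms. *)
  transitivity (op_ip ip (Rr A + rmult lambda X) (Rr B + rmult lambda Y)).
    rewrite /op_ip (lftrace_adj bF); apply: eq_bigr => x _.
    by rewrite !mu_W ipeE linear0 add0r !add_lfunE !rmultE.
  rewrite op_ipDl !op_ipDr R_lambda_orth [op_ip ip (rmult _ _) _]op_ipC R_lambda_orth.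
  rewrite conjC0 addr0 add0r; congr (_ + _); rewrite /op_ip (lftrace_adj bF).
  by apply: eq_bigr => x _; rewrite !rmultE.
have S3 : \sum_(p <- P) ipe (mu (j A X) p) (mu (j B Y) p) =
    op_ip ipf (ad A) (ad B) + \sum_(a <- E) ip (Rr a X) (Rr a Y) +
    op_ip ip (L A) (L B) + \sum_(x <- F) ip (lambda X x) (lambda Y x).
  rewrite sumP -addrA; congr (_ + _).
    rewrite /op_ip (lftrace_adj bE) -big_split /=.
    by apply: eq_bigr => a _; rewrite !muf_ ipeE.
  transitivity (op_ip ip (L A + lambda X) (L B + lambda Y)).
    rewrite /op_ip (lftrace_adj bF); apply: eq_bigr => x _.
    by rewrite !muW_ ipeE linear0 add0r !add_lfunE.
  rewrite op_ipDl !op_ipDr L_lambda_orth [op_ip ip (lambda _) _]op_ipC L_lambda_orth.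
  by rewrite conjC0 addr0 add0r; congr (_ + _); rewrite /op_ip (lftrace_adj bF).
have [ME _] := MlambdaE.
have lE : ip (c%:C *: X + D X) Y = ip (Mop ip lambda X) Y.
  by rewrite ME add_lfunE scale_lfunE id_lfunE.
have aE : op_ip ipf (ad A) (ad B) = op_ip ip1 (ad A) (ad B).
  by rewrite /op_ip adj_adE.
rewrite Mop_Mpol (Mpol_dot _ _ _ _ bP) S1 S2 S3 ipeE lE.
rewrite Mop_Mpol (Mpol_dot _ _ _ _ bF) linearZl_LR /= ipfE aE /ext_trace.
(* In 2 S1 - 2 S2 - 2 S3 the [ad] and [L] sums of [S1] cancel against [S2] and its [Rr] sum against
   [S3]. Besides M of lambda this leaves - 2 times [ext_trace A B]. *)
have cE : c%:C * - (2 / c)%:C = - 2.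
  by rewrite mulrN -rmorphM mulrC divfK ?lt_eqF // rmorph_nat.
rewrite [c%:C * _]mulrA cE; ring.
Qed.

(** M - c is zero on [f] and D on [W]. For such an operator the derivation rule on mixed products is
    precisely condition (i). *)
Lemma ext_decomposition : exists2 De : 'End(V),
  Mop_decomposition ipe mu c De & forall A X, De (j A X) = j 0 (D X).
Proof.
have DeE A X : (Mop ipe mu - c%:C *: \1%VF) (j A X) = j 0 (D X).
  rewrite add_lfunE opp_lfunE scale_lfunE id_lfunE Mop_ext -scaleNr !jZ jD.
  by rewrite !scaleNr subrr addrC addKr.
exists (Mop ipe mu - c%:C *: \1%VF) => //; split; first by rewrite addrC subrK.
have [_ dD] := MlambdaE.
have DLA A Y : D (L A Y) = L A (D Y).
  by have := congr1 (fun f : 'End(W) => f Y) (DL A); rewrite !comp_lfunE.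
have DRA A Y : D (Rr A Y) = Rr A (D Y).
  by have := congr1 (fun f : 'End(W) => f Y) (DR A); rewrite !comp_lfunE.
move=> u v; have [A [X ->]] := j_surj u; have [B [Y ->]] := j_surj v.
rewrite muE !DeE !muE jD !linear0 !zero_lfunE !add0r !addr0.
rewrite !linearD /= dD DLA DRA -!addrA; congr (j 0 _).
by rewrite [lambda _ _ + (_ + _) in RHS]addrCA [RHS]addrCA.
Qed.

End Extension.

(** * The spectrum of the extended derivation *)

Section Spectrum.

Lemma leigenspaceP (K : fieldType) (V : vectType K) (f : 'End(V)) a v :
  reflect (f v = a *: v) (v \in passmx.leigenspace f a).
Proof.
rewrite memv_ker add_lfunE opp_lfunE scale_lfunE id_lfunE subr_eq0.
exact: eqP.
Qed.

Lemma leigenvalueP (K : fieldType) (V : vectType K) (f : 'End(V)) a :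
  passmx.leigenvalue f a <-> exists2 v, v != 0 & f v = a *: v.
Proof.
split=> [fa|[v v0 fv]].
  exists (vpick (passmx.leigenspace f a)); first by rewrite vpick0.
  by apply/leigenspaceP; exact: memv_pick.
apply: contra_neqN v0 => /eqP f0; apply/eqP; rewrite -memv0 -f0.
exact/leigenspaceP.
Qed.

Variables (R : realType) (U W V : vectType R[i]) (j : U -> W -> V).
Hypotheses (j_lin : forall k a b x y,
    j (k *: a + b) (k *: x + y) = k *: j a x + j b y)
  (j_inj : forall a b x y, j a x = j b y -> a = b /\ x = y)
  (j_surj : forall v, exists a x, v = j a x).

(** As 0 is not among the [ks], aD is injective: the kernel of a De is exactly the copy of [U],
    nonzero by the dimension hypothesis, and the other eigenspaces are copies of those of aD. *)
Lemma has_spectrum_ext (D : 'End(W)) (De : 'End(V)) (a : R[i])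
    (ks : seq int) (ds : seq nat) :
    (0 < \dim {:U})%N -> a != 0 -> (forall A X, De (j A X) = j 0 (D X)) ->
    {in ks, forall k, k != 0} ->
  has_spectrum (a *: D) ks ds ->
  has_spectrum (a *: De) (0 :: ks) (\dim {:U} :: ds).
Proof.
move=> U0 a0 DeE ks0 [sz ev dm].
have aDe A X : (a *: De) (j A X) = j 0 ((a *: D) X).
  by rewrite scale_lfunE DeE (jZ j_lin) scaler0 scale_lfunE.
have kint (k : int) : (k%:~R == 0 :> R[i]) = (k == 0) by rewrite intr_eq0.
have j00 : j 0 0 = 0 by have := jZ j_lin 0 0 0; rewrite !scale0r.
have j_eq0 A X : j A X = 0 -> A = 0 /\ X = 0 by exact: j_eq0.
have ker0 X : (a *: D) X = 0 -> X = 0.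
  move=> aDX; apply/eqP/negPn/negP => X0.
  have /ev [k kk /eqP] : passmx.leigenvalue (a *: D) 0.
    by apply/leigenvalueP; exists X; rewrite // scale0r.
  by rewrite eq_sym kint (negPf (ks0 k kk)).
split; first by rewrite /= sz.
- move=> e; split=> [/leigenvalueP [v]|].
    have [A [X ->]] := j_surj v => v0; rewrite aDe (jZ j_lin) => /j_inj [eA aX].
    have [->|e0] := eqVneq e 0; first by exists 0; rewrite ?mem_head.
    have A0 : A = 0.
      by apply/eqP; move/esym/eqP: eA; rewrite scaler_eq0 (negPf e0).
    have X0 : X != 0 by apply: contra_neq v0 => ->; rewrite A0.
    have /ev [k kk ->] : passmx.leigenvalue (a *: D) e by apply/leigenvalueP; exists X.
    by exists k; rewrite // inE kk orbT.
  case=> k; rewrite inE => /predU1P[-> ->|kk ke].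
    apply/leigenvalueP; exists (j (vpick {:U}) 0).
      apply/eqP => /j_eq0 [/eqP]; rewrite vpick0 -dimv_eq0.
      by move=> /eqP dU; rewrite dU in U0.
    by rewrite aDe linear0 scale0r j00.
  have /leigenvalueP [X X0 XE] : passmx.leigenvalue (a *: D) e by apply/ev; exists k.
  apply/leigenvalueP; exists (j 0 X).
    by apply/eqP => /j_eq0 [_ /eqP]; rewrite (negPf X0).
  by rewrite aDe XE (jZ j_lin) scaler0.
- case=> [_|i] /=.
    have linU : linear (j^~ 0) by move=> k x y; rewrite -j_lin scaler0 addr0.
    pose iU := linfun (j^~ 0).
    have iUE x : iU x = j x 0 by rewrite linfun_linear.
    have -> : passmx.leigenspace (a *: De) 0 = (iU @: fullv)%VS.
      apply/vspaceP => v; apply/leigenspaceP/memv_imgP => [|[A _ ->]].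
        have [A [X ->]] := j_surj v; rewrite aDe scale0r => /j_eq0[_ /ker0 ->].
        by exists A; rewrite ?memvf ?iUE.
      by rewrite iUE aDe linear0 scale0r.
    apply: limg_dim_eq; apply/eqP; rewrite -subv0; apply/subvP => x.
    rewrite memv_cap memv_ker iUE => /andP[_ /eqP /j_eq0[-> _]].
    exact: mem0v.
  rewrite ltnS => isz; rewrite -dm //.
  have linW : linear (j 0).
    by move=> k x y; rewrite -j_lin scaler0 addr0.
  pose iW := linfun (j 0).
  have iWE x : iW x = j 0 x by rewrite linfun_linear.
  set k := nth 0 ks i; have k0 : (k%:~R : R[i]) != 0.
    by rewrite kint ks0 // mem_nth.
  have -> : passmx.leigenspace (a *: De) k%:~R =
      (iW @: passmx.leigenspace (a *: D) k%:~R)%VS.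
    apply/vspaceP => v; apply/leigenspaceP/memv_imgP.
      have [A [X ->]] := j_surj v; rewrite aDe (jZ j_lin) => /j_inj[kA aX].
      exists X; first exact/leigenspaceP.
      rewrite iWE; congr (j _ _); apply/eqP; move/esym/eqP: kA.
      by rewrite scaler_eq0 (negPf k0).
    by move=> [X /leigenspaceP aX ->]; rewrite iWE aDe aX (jZ j_lin) scaler0.
  apply: limg_dim_eq; apply/eqP; rewrite -subv0; apply/subvP => x.
  rewrite memv_cap => /andP[_]; rewrite memv_ker iWE => /eqP /j_eq0[_ ->].
  exact: mem0v.
Qed.

End Spectrum.

Theorem theorem4p13 (R : realType) (d1 m : nat) (d1_gt0 : (0 < d1)%N)
  (* the reductive Lie algebra f = h + z *)
  (ad : product_on 'cV[R[i]]_d1) (h z : {vspace 'cV[R[i]]_d1})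
  (fP : reductive ad h z)
  (* the critical point lambda *)
  (ip : {dot 'cV[R[i]]_m for conjC}) (lambda : product_on 'cV[R[i]]_m)
  (k2 : int) (ks : seq int) (d2 : nat) (ds : seq nat)
  (lambdaP : leibniz_critical_of_type ip lambda (k2 :: ks) (d2 :: ds))
  (k2_gt0 : 0 < k2)
  (c : R) (D : 'End('cV[R[i]]_m))
  (MlambdaE : Mop_decomposition ip lambda c D)
  (* rho = (L, R): L A Y = L_A(Y) and Rr A X = R_A(X) *)
  (L Rr : 'Hom('cV[R[i]]_d1, 'End('cV[R[i]]_m)))
  (mu : product_on ('cV[R[i]]_d1 * 'cV[R[i]]_m)%type)
  (muE : forall A B X Y,
     mu (A, X) (B, Y) = (ad A B, L A Y + Rr B X + lambda X Y))
  (mu_leibniz : symmetric_leibniz mu)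
  (* condition (i) *)
  (DL : forall A, (D \o L A = L A \o D)%VF)
  (DR : forall A, (D \o Rr A = Rr A \o D)%VF)
  (* condition (ii) *)
  (Lnormal : forall Z, Z \in z -> normal_op ip (L Z))
  (Rnormal : forall Z, Z \in z -> normal_op ip (Rr Z))
  (LR_neq0 : forall Z, Z \in z -> Z != 0 -> L Z != 0 \/ Rr Z != 0)
  (* the auxiliary inner product and its orthonormal basis *)
  (ip1 : {dot 'cV[R[i]]_d1 for conjC}) (Hs Zs : seq 'cV[R[i]]_d1)
  (Hs_h : {in Hs, forall H, H \in h}) (Zs_z : {in Zs, forall Z, Z \in z})
  (HZ_onb : orthonormal_basis ip1 (Hs ++ Zs))
  (ad_skew : {in Hs, forall H, adj ip1 (ad H) = - ad H})
  (L_skew : {in Hs, forall H, adj ip (L H) = - L H})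
  (R_skew : {in Hs, forall H, adj ip (Rr H) = - Rr H}) :
  exists2 ipe : {dot ('cV[R[i]]_d1 * 'cV[R[i]]_m)%type for conjC},
    forall A B X Y,
      ipe (A, X) (B, Y) =
        - (2 / c)%:C * (lftrace (ad A \o adj ip1 (ad B))%VF
                        + lftrace (L A \o adj ip (L B))%VF
                        + lftrace (Rr A \o adj ip (Rr B))%VF)
        + ip X Y
  & leibniz_critical_of_type ipe mu (0 :: k2 :: ks) (d1 :: d2 :: ds).
Proof.
have [[_ [lambda0 _]] [sorted_ks gcd_ks [c' [D' [a [MD' a0 spec]]]]]] := lambdaP.
have [cc' DD'] := decomposition_unique lambda0 MlambdaE MD'.
subst c' D'.
have c_lt0 := decomposition_lt0 MlambdaE lambda0.
have ks_neq0 : {in k2 :: ks, forall k, k != 0}.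
  move=> k; rewrite inE => /predU1P[->|kk]; first by rewrite gt_eqF.
  have /allP /(_ k kk) := order_path_min lt_trans sorted_ks.
  by move=> /(lt_trans k2_gt0) /gt_eqF ->.
have aC0 : a%:C != 0 :> R[i].
  by rewrite -(rmorph0 (real_complex R)) (inj_eq (@complexI R)) gt_eqF.
(* A kernel vector would make 0 an eigenvalue of aD, but all of these are at least k2 > 0. *)
have D_inj : lker D == 0%VS.
  rewrite -subv0; apply/subvP => X; rewrite memv_ker memv0 => /eqP DX0.
  apply/negPn/negP => X0; have [_ ev _] := spec.
  have /ev [k kk /esym/eqP] : passmx.leigenvalue (a%:C *: D) 0.
    by apply/leigenvalueP; exists X; rewrite // scale_lfunE DX0 scaler0 scale0r.
  by rewrite intr_eq0 (negPf (ks_neq0 k kk)).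
have HZ_full : <<Hs ++ Zs>>%VS = fullv by apply: span_basis; exact: HZ_onb.1.
pose j (A : 'cV[R[i]]_d1) (X : 'cV[R[i]]_m) := (A, X).
have j_lin k A B X Y : j (k *: A + B) (k *: X + Y) = k *: j A X + j B Y by [].
have j_inj A B X Y : j A X = j B Y -> A = B /\ X = Y by case.
have j_surj v : exists A X, v = j A X by case: v => A X; exists A, X.
have dimU : \dim {:'cV[R[i]]_d1} = d1 by rewrite dimvf /= /dim /= muln1.
have muE' A B X Y : mu (j A X) (j B Y) = j (ad A B) (L A Y + Rr B X + lambda X Y).
  exact: muE.
have [ipf ipfE] := ext_dot_ex fP ip c_lt0 LR_neq0 ip1.
have [ipe ipeE] := product_dot_ex ipf ip.
have ipeE' A B X Y : ipe (j A X) (j B Y) = ipf A B + ip X Y by exact: ipeE.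
clearbody j.
have [De MDe DeE] := ext_decomposition j_lin j_inj j_surj fP MlambdaE c_lt0
  D_inj muE' mu_leibniz DL DR Lnormal Rnormal Hs_h Zs_z HZ_full ad_skew L_skew
  R_skew ipfE ipeE'.
have mu0 : mu != 0 by exact: (ext_neq0 j_lin j_inj muE' lambda0).
exists ipe; first by move=> A B X Y; rewrite ipeE ipfE.
split; first by split=> //; exact: (decomposition_critical mu0 MDe).
split.
- by rewrite /= k2_gt0.
(* Adjoining 0 does not change the gcd, and k2 > 0 excludes the degenerate type of [lambda]. *)
- right; rewrite big_cons absz0 gcd0n; case: gcd_ks => // [[k20]].
  by rewrite k20 ltxx in k2_gt0.
- exists c, De, a; split=> //.
  have := has_spectrum_ext j_lin j_inj j_surj _ aC0 DeE ks_neq0 spec.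
  by rewrite dimU; apply.
Qed.
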